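(* For every open interval $\beta=(\beta^{(1)},\beta^{(2)})\subseteq\mathbb{R}_{+}$ and every $\epsilon>0$, there exist a sufficiently large integer $D=D(\beta,\epsilon)\in\mathbb{N}$ and a sufficiently small real number $\mu=\mu(\beta,\epsilon)>0$ such that there is an infinite explicit family of $(\mu,\epsilon)$-lossless expanders $G$ with left-degree $D$ and with $|R(G)|/|L(G)|\in(\beta^{(1)},\beta^{(2)})$.
   Context: A bipartite graph $G$ has vertex set $V(G)=L(G)\sqcup R(G)$ (left and right vertex sets). For $S\subseteq V(G)$, $N_G(S)$ denotes the set of neighbors of $S$ in $G$. For real numbers $0\leq\mu,\epsilon\leq 1$, a bipartite graph $G$ with left-degree $d$ (every left vertex has degree $d$) is a (onesided) $(\mu,\epsilon)$-lossless expander if for every $S\subseteq L(G)$ with $|S|\leq\mu|L(G)|$ it holds that $|N_G(S)|\geq(1-\epsilon)d|S|$. An infinite explicit family means an infinite family of graphs, with unboundedly many vertices, that can be constructed deterministically in time polynomial in the number of vertices. *)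

(* Defs.v *)
From mathcomp Require Import all_boot all_order all_algebra.
From mathcomp Require Import reals.

Set Implicit Arguments.
Unset Strict Implicit.
Unset Printing Implicit Defensive.

Import Order.TTheory GRing.Theory Num.Theory.

(** * Bipartite graphs *)

(* A finite simple bipartite graph with vertex set 'I_nL + 'I_nR; the vertices
   are numbered so that an algorithm can output the graph. *)
Record bigraph := BiGraph {
  nL : nat;
  nR : nat;
  adj : 'I_nL -> 'I_nR -> bool
}.

Definition order (G : bigraph) : nat := nL G + nR G.

Definition nbrs (G : bigraph) (S : {set 'I_(nL G)}) : {set 'I_(nR G)} :=
  [set v | [exists u in S, adj u v]].

Definition left_regular (d : nat) (G : bigraph) : Prop :=
  forall u : 'I_(nL G), #|[set v | adj u v]| = d.

Definition lossless_expander (R : realType) (mu eps : R) (d : nat)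
    (G : bigraph) : Prop :=
  left_regular d G /\
  forall S : {set 'I_(nL G)},
    (#|S|%:R <= mu * (nL G)%:R)%R ->
    ((1 - eps) * d%:R * #|S|%:R <= #|nbrs S|%:R)%R.

(** * Polynomial time

  The model of computation is the unit-cost successor RAM, with structured
  control flow. Memory is an infinite array of natural numbers, addresses are
  computed (indirect addressing), and the arithmetic operations are successor
  and predecessor. In one step numbers grow by at most a constant depending on
  the program, so unit cost is polynomially related to Turing machine time;
  addition and multiplication are loops, whose cost is polynomial in the values
  involved. *)

Inductive expr :=
| Const of nat
| Get of expr
| Succ of expr
| Pred of expr.

Inductive cmd :=
| Skip
| Store of expr & expr
| Seq of cmd & cmd
| If of expr & cmd & cmd
| While of expr & cmd.

Definition memory := nat -> nat.

Definition update (s : memory) (a v : nat) : memory :=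
  fun b => if b == a then v else s b.

Fixpoint eval (s : memory) (e : expr) : nat :=
  match e with
  | Const n => n
  | Get e1 => s (eval s e1)
  | Succ e1 => (eval s e1).+1
  | Pred e1 => (eval s e1).-1
  end.

(* [exec c s t s'] : started in memory s, the program c halts after t steps in
   memory s'. A test is true when its value is nonzero. *)
Inductive exec : cmd -> memory -> nat -> memory -> Prop :=
| ExecSkip s : exec Skip s 1 s
| ExecStore a e s : exec (Store a e) s 1 (update s (eval s a) (eval s e))
| ExecSeq c1 c2 s1 s2 s3 t1 t2 :
    exec c1 s1 t1 s2 -> exec c2 s2 t2 s3 -> exec (Seq c1 c2) s1 (t1 + t2) s3
| ExecIfTrue e c1 c2 s s' t :
    eval s e != 0 -> exec c1 s t s' -> exec (If e c1 c2) s t.+1 s'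
| ExecIfFalse e c1 c2 s s' t :
    eval s e = 0 -> exec c2 s t s' -> exec (If e c1 c2) s t.+1 s'
| ExecWhileTrue e c s1 s2 s3 t1 t2 :
    eval s1 e != 0 -> exec c s1 t1 s2 -> exec (While e c) s2 t2 s3 ->
    exec (While e c) s1 (t1 + t2).+1 s3
| ExecWhileFalse e c s : eval s e = 0 -> exec (While e c) s 1 s.

Definition input (n : nat) : memory := update (fun=> 0) 0 n.

(* The two sizes, followed by the adjacency matrix in row-major order. *)
Definition encodes (s : memory) (G : bigraph) : Prop :=
  [/\ s 0 = nL G,
      s 1 = nR G
    & forall (u : 'I_(nL G)) (v : 'I_(nR G)),
        s (2 + (u * nR G + v)) = nat_of_bool (adj u v)].

(* The time bound is polynomial in the number of vertices of the graph being
   output. The index n is effectively given in unary: a program can only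
   compare it with other values by counting, so in t steps it cannot tell apart
   two indices that are large compared with t. *)
Definition poly_time_constructible (G : nat -> bigraph) : Prop :=
  exists (c : cmd) (a k : nat), forall n : nat,
    exists (t : nat) (s : memory),
      [/\ exec c (input n) t s,
          encodes s (G n)
        & t <= a * (order (G n) ^ k).+1].

Definition infinite_explicit_family (G : nat -> bigraph) : Prop :=
  (forall m : nat, exists n : nat, m <= order (G n)) /\
  poly_time_constructible G.

(* Main.v *)
(* Let V = (Z/m)^2, acted upon by the identity, two translations and two shears.
   A left vertex is a pair (v, l), where l is a word of p (k - 1) such maps; the
   walk from v along l is observed at times 0, p, ..., p (k - 1). It is joined to
   the right vertices (w, a, r) such that w is the position at time p a and
   r belongs to h l, where h is a bipartite graph of constant size which is
   lossless on all sets of at most a constant fraction of the labels (union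
   bound over random graphs).

   For a small set S of left vertices, call a block (w, a) heavy if too many
   elements of S pass through it for h to be lossless there. There are at most
   O(|S|) / 5 ^ (p (k - 1)) heavy blocks. As the walks mix between two
   observations, few elements of S meet two heavy blocks; the others lose at
   most the edges to one of their k blocks.

   The mixing comes from a spectral gap. The Fourier transform of a function
   that is almost invariant under the translations is concentrated near the
   origin, where the shears play ping-pong; so a function of mean zero cannot be
   almost invariant under all the maps. *)

Require Import Defs.
From mathcomp Require Import all_boot all_order all_algebra.
From mathcomp Require Import reals.
From mathcomp Require Import all_field.
From mathcomp Require Import ring lra zify.

Import Order.TTheory GRing.Theory Num.Theory.
Local Open Scope ring_scope.

Set Implicit Arguments.
Unset Strict Implicit.

(** * Spectral gap *)

(** The constants have to be chosen without a circle. There are D = 5 ^ (p (k - 1)) labels, so the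
    gadget grows with the walk length p, while p must be large enough for a mixing rate dictated by
    the gadget's threshold z. The way out is that z depends only on the degree and on a bound g for
    D / M, not on D: one fixes k, g, z, q = k ^ 3 z, p and M in this order. The ratio of the two
    sides is tuned by M alone, as it equals k M / D up to padding.

    Explicitness survives the probabilistic choice of h because h has constant size: the program
    carries it as straight-line code, and only V grows with the index.

    The identity is among the maps so that each energy, a sum of squares of f (T v) - f v, appears
    directly when the square of the walk operator is expanded. The walk operator need not be
    symmetric, and contraction is proved for its norm. *)

Definition step := option (bool * bool).

Definition act (m : nat) (o : step) (v : 'I_m.+2 * 'I_m.+2) :
    'I_m.+2 * 'I_m.+2 :=
  match o with
  | None => v
  | Some (false, false) => (v.1 + 1, v.2)
  | Some (false, true) => (v.1, v.2 + 1)
  | Some (true, false) => (v.1 + v.2, v.2)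
  | Some (true, true) => (v.1, v.2 + v.1)
  end.
Arguments act {m} o v.

Lemma act_inj (m : nat) (o : step) : injective (@act m o).
Proof.
move=> [x y] [x' y']; case: o => [[[] []]|] //= /eqP;
  rewrite xpair_eqE => /andP[/eqP h1 /eqP h2].
- by move: h2; rewrite h1 => /addIr ->.
- by move: h1; rewrite h2 => /addIr ->.
- by move/addIr: h2 => ->; rewrite h1.
- by move/addIr: h1 => ->; rewrite h2.
Qed.

Lemma swapK (T : Type) : involutive (fun v : T * T => (v.2, v.1)).
Proof. by case. Qed.

(* Valued in [algR], a real field, so that [lra] applies. *)
Definition nm (z : algC) : algR := in_algR (normr_real z).

Lemma nm_ge0 z : 0 <= nm z.
Proof. by have := normr_ge0 z. Qed.

Lemma nmD z1 z2 : nm (z1 + z2) <= nm z1 + nm z2.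
Proof. exact: ler_normD. Qed.

Lemma nmM z1 z2 : nm (z1 * z2) = nm z1 * nm z2.
Proof. by apply/val_inj; rewrite /= normrM. Qed.

Lemma nmN z : nm (- z) = nm z.
Proof. by apply/val_inj; rewrite /= normrN. Qed.

Lemma nm0_eq0 z : nm z = 0 -> z = 0.
Proof. by move=> /(congr1 val) /= /normr0_eq0. Qed.

(** * Fourier analysis on the torus and ping-pong of the shears *)

Section Fourier.

Variables (m : nat) (w : algC).
Hypothesis w_prim : m.+2.-primitive_root w.
Local Notation Z := 'I_m.+2.
Local Notation V := ('I_m.+2 * 'I_m.+2)%type.

Definition chr (a : Z) : algC := w ^+ a.

Lemma chrD a b : chr (a + b) = chr a * chr b.
Proof. by rewrite /chr -exprD -(prim_expr_mod w_prim (a + b)). Qed.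

Lemma chr0 : chr 0 = 1.
Proof. by rewrite /chr expr0. Qed.

Lemma chr_eq1 a : (chr a == 1) = (a == 0).
Proof.
rewrite /chr -(expr0 w) (eq_prim_root_expr w_prim) !modn_small //.
Qed.

Lemma norm_chr a : `|chr a| = 1.
Proof.
have: `|w| ^+ m.+2 = 1 by rewrite -normrX (prim_expr_order w_prim) normr1.
move/eqP; rewrite pexpr_eq1 // => /eqP w1.
by rewrite /chr normrX w1 expr1n.
Qed.

Lemma chrN a : chr (- a) = (chr a)^*.
Proof.
have a0 : chr a != 0 by rewrite -normr_eq0 norm_chr oner_eq0.
apply: (mulfI a0); rewrite -chrD subrr chr0 -normCK norm_chr expr1n //.
Qed.

Lemma sum_chr a : \sum_(b : Z) chr (b * a) = if a == 0 then m.+2%:R else 0.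
Proof.
case: eqP => [->|/eqP a0].
  under eq_bigr do rewrite mulr0 chr0.
  by rewrite sumr_const card_ord.
have: (chr a - 1) * (\sum_(b : Z) chr (b * a)) = 0.
  rewrite mulrBl mul1r mulr_sumr.
  have chr_succ b : chr a * chr (b * a) = chr ((b + 1) * a).
    by rewrite -chrD; congr chr; ring.
  under eq_bigr do rewrite chr_succ.
  rewrite [X in _ - X](reindex_inj (addIr 1)) /=.
  by rewrite subrr.
move/eqP; rewrite mulf_eq0 subr_eq0 chr_eq1 (negPf a0) /=.
by move/eqP.
Qed.

(** A distance of [a] from 0 in the cyclic group: symmetric, subadditive, and nearly doubled by
    doubling when it is small. *)
Definition gap (a : Z) : algR := nm (1 - chr a).

Lemma gap_ge0 a : 0 <= gap a. Proof. exact: nm_ge0. Qed.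

Lemma gap_eq0 a : gap a = 0 -> a = 0.
Proof.
by move=> /nm0_eq0 /eqP; rewrite subr_eq0 eq_sym chr_eq1 => /eqP.
Qed.

Lemma gapN a : gap (- a) = gap a.
Proof.
apply/val_inj; rewrite /= chrN.
by rewrite -[1 in LHS](rmorph1 (@Num.conj algC)) -rmorphB norm_conjC.
Qed.

Lemma gapD a b : gap (a + b) <= gap a + gap b.
Proof.
have -> : gap b = nm (chr a * (1 - chr b)).
  by rewrite nmM; apply/val_inj; rewrite /= norm_chr mul1r.
rewrite /gap chrD; apply: le_trans (nmD _ _).
by have <- : 1 - chr a + chr a * (1 - chr b) = 1 - chr a * chr b by ring.
Qed.

(* [1 - z^2 = (1 - z) (2 - (1 - z))] *)
Lemma gap_double a : gap a * (2 - gap a) <= gap (a + a).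
Proof.
have -> : gap (a + a) = gap a * nm (1 + chr a).
  by rewrite -nmM /gap chrD; congr nm; ring.
apply: (ler_wpM2l (gap_ge0 a)).
have : nm 2 <= nm (1 - chr a) + nm (1 + chr a).
  apply: le_trans (nmD _ _).
  by have <- : 1 - chr a + (1 + chr a) = 2 by ring.
have -> : nm 2 = 2 by apply/val_inj; rewrite /= normr_nat.
by rewrite /gap; lra.
Qed.

Definition hat (f : V -> algR) (k : V) : algC :=
  \sum_(v : V) algRval (f v) * chr (k.1 * v.1 + k.2 * v.2).

Definition mass (f : V -> algR) (k : V) : algR := nm (hat f k) ^+ 2.

Lemma mass_ge0 f k : 0 <= mass f k.
Proof. exact: exprn_ge0 (nm_ge0 _). Qed.

Lemma parseval f : \sum_k mass f k = (m.+2 ^ 2)%:R * \sum_v f v ^+ 2.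
Proof.
have chr_diff (k v v' : V) :
    chr (k.1 * v.1 + k.2 * v.2 - (k.1 * v'.1 + k.2 * v'.2))
    = chr (k.1 * (v.1 - v'.1)) * chr (k.2 * (v.2 - v'.2)).
  by rewrite -chrD; congr chr; ring.
have val_mass k : algRval (mass f k) = hat f k * (hat f k)^*.
  by rewrite -normCK /mass rmorphXn.
apply/val_inj; rewrite -[LHS]/(algRval _) -[RHS]/(algRval _).
rewrite rmorph_sum rmorphM rmorph_nat rmorph_sum.
rewrite (eq_bigr _ (fun k _ => val_mass k)).
under eq_bigr => k _.
  rewrite {2}/hat rmorph_sum /hat mulr_suml.
  under eq_bigr => v _.
    rewrite mulr_sumr.
    under eq_bigr => v' _.
      rewrite rmorphM /= -chrN (CrealP (algRvalP _)).
      rewrite mulrACA -chrD chr_diff.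
    over.
  over.
over.
rewrite exchange_big mulr_sumr; apply: eq_bigr => v _ /=.
rewrite exchange_big /= (bigD1 v) //= [X in _ + X]big1.
  rewrite -mulr_sumr !subrr addr0 rmorphXn /= -expr2 mulrC; congr (_ * _).
  under eq_bigr do rewrite !mulr0 !chr0 mulr1.
  by rewrite sumr_const card_prod card_ord mulnn.
move=> v' v'v; rewrite -mulr_sumr.
rewrite -(pair_bigA _ (fun a b => chr (a * (v.1 - v'.1)) * chr (b * (v.2 - v'.2)))) /=.
under eq_bigr do rewrite -mulr_sumr.
rewrite -mulr_suml !sum_chr !subr_eq0.
have : ~~ ((v.1 == v'.1) && (v.2 == v'.2)).
  apply: contraNN v'v => /andP[/eqP h1 /eqP h2].
  by rewrite [v]surjective_pairing [v']surjective_pairing h1 h2.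
by rewrite negb_and => /orP[] /negPf ->; rewrite ?mul0r ?mulr0.
Qed.

Lemma hatB f g k : hat (fun v => f v - g v) k = hat f k - hat g k.
Proof.
by rewrite /hat -sumrB; apply: eq_bigr => v _; rewrite rmorphB mulrBl.
Qed.

Lemma hat_swap f k : hat (fun v => f (v.2, v.1)) k = hat f (k.2, k.1).
Proof.
rewrite /hat (reindex_inj (inv_inj (@swapK _))) /=.
by apply: eq_bigr => -[x y] _ /=; rewrite addrC.
Qed.

Lemma hat_inc f k :
  hat (fun v => f (act (Some (false, false)) v)) k = chr (- k.1) * hat f k.
Proof.
rewrite /hat mulr_sumr.
rewrite [RHS](reindex_inj (@act_inj m (Some (false, false)))) /=.
apply: eq_bigr => -[x y] _ /=.
rewrite mulrCA -chrD; congr (_ * chr _); ring.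
Qed.

Definition shear (c : Z) (v : V) : V := (v.1 + c * v.2, v.2).

Lemma shearK c : cancel (shear c) (shear (- c)).
Proof. by case=> x y; rewrite /shear /=; congr (_, _); ring. Qed.

(** On frequencies a shear acts by its inverse transpose, which is again a shear, with the
    coordinates in exchanged roles. *)
Lemma hat_shear f c k :
  hat (fun v => f (shear c v)) k = hat f (k.1, k.2 - c * k.1).
Proof.
rewrite /hat [RHS](reindex_inj (can_inj (shearK c))) /=.
apply: eq_bigr => -[x y] _ /=.
congr (_ * chr _); ring.
Qed.

Definition energy (T : V -> V) (f : V -> algR) : algR :=
  \sum_v (f (T v) - f v) ^+ 2.

Lemma energy_ge0 T f : 0 <= energy T f.
Proof. by apply: sumr_ge0 => v _; apply: sqr_ge0. Qed.

(** From the shear by 1, repeated doubling reaches the shears by 4 and 8 at the cost of factors 16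
    and 64; hence the constant 400 = 5 (16 + 64) in the ping-pong. *)
Lemma energy_shear_double f c :
  energy (shear (c + c)) f <= 4 * energy (shear c) f.
Proof.
have -> : 4 * energy (shear c) f
    = \sum_v (2 * (f (shear c (shear c v)) - f (shear c v)) ^+ 2
              + 2 * (f (shear c v) - f v) ^+ 2).
  rewrite big_split /= -!mulr_sumr.
  have <- : energy (shear c) f
      = \sum_v (f (shear c (shear c v)) - f (shear c v)) ^+ 2.
    by rewrite /energy (reindex_inj (can_inj (shearK c))).
  by rewrite /energy; ring.
apply: ler_sum => v _.
have -> : shear (c + c) v = shear c (shear c v).
  by rewrite /shear /=; congr (_, _); ring.
have := sqr_ge0 (f (shear c (shear c v)) - 2 * f (shear c v) + f v).
nra.
Qed.

(** This is (y + z)^2 <= 5/4 y^2 + 5 z^2. The weight 5/4 has to stay below 2, the number of disjoint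
    images in the ping-pong. *)
Lemma mass_diff_shear f c k :
  mass f k <= 5/4 * mass f (k.1, k.2 - c * k.1)
              + 5 * mass (fun v => f (shear c v) - f v) k.
Proof.
rewrite /mass -hat_shear hatB.
set a := hat f k; set b := hat _ k.
have : nm a <= nm b + nm (b - a).
  rewrite -[nm (b - a)]nmN; apply: le_trans (nmD _ _).
  by have <- : a = b + - (b - a) by ring.
move: (nm a) (nm b) (nm (b - a)) (nm_ge0 a) => x y z x0 le_xyz.
have := sqr_ge0 (y / 2 - 2 * z).
have : x ^+ 2 <= (y + z) ^+ 2 by rewrite lerXn2r // nnegrE; lra.
lra.
Qed.

Lemma gap_mul4 a : gap a <= 1/16 -> 29/8 * gap a <= gap (4 * a) <= 4 * gap a.
Proof.
move=> a_small; have a0 := gap_ge0 a.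
have -> : 4 * a = (a + a) + (a + a) by ring.
have := gapD a a; have := gap_double a.
have := gapD (a + a) (a + a); have := gap_double (a + a).
move: (gap a) (gap (a + a)) (gap (a + a + (a + a))) a0 a_small => x y z *.
have le_xy : x * (31/16) <= y.
  have : 0 <= x * (1/16 - x) by apply: mulr_ge0; lra.
  by lra.
have : 0 <= y * (1/8 - y) by apply: mulr_ge0; lra.
by move=> ?; apply/andP; split; lra.
Qed.

Lemma gap_mul8 a : gap a <= 1/16 -> 101/16 * gap a <= gap (8 * a).
Proof.
move=> a_small; have a0 := gap_ge0 a.
have /andP[] := gap_mul4 a_small.
have -> : 8 * a = 4 * a + 4 * a by ring.
have := gap_double (4 * a).
move: (gap a) (gap (4 * a)) (gap (4 * a + 4 * a)) a0 a_small => x y z *.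
have : 0 <= y * (1/4 - y) by apply: mulr_ge0; lra.
by lra.
Qed.

Lemma gap_sub_le a b : gap a <= gap (b + a) + gap b.
Proof.
have {1}-> : a = (b + a) + - b by ring.
by rewrite -(gapN b); exact: gapD.
Qed.

(** If [gap (c * a)] were [c] times [gap a], then [gap b] would lie between [c - 1] and [c + 1]
    times [gap a]. The ranges for 4 and 8 are [3, 5] and [7, 9], with room between them for the
    error of doubling; those for 2 and 4 would touch. *)
Lemma gap_shear4 a b :
  gap (b + 4 * a) <= gap a -> gap a <= 1/16 -> 0 < gap a ->
  gap a < gap b <= 5 * gap a.
Proof.
move=> h1 h2 h3; have /andP[] := gap_mul4 h2.
have := gap_sub_le (4 * a) b; have := gap_sub_le b (4 * a).
by rewrite [4 * a + b]addrC => *; apply/andP; split; lra.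
Qed.

Lemma gap_shear8 a b :
  gap (b + 8 * a) <= gap a -> gap a <= 1/16 -> 0 < gap a ->
  5 * gap a < gap b.
Proof.
by move=> h1 h2 h3; have := gap_mul8 h2; have := gap_sub_le (8 * a) b; lra.
Qed.

(** The last condition removes just the origin: it is fixed by every shear, and a function of mean
    zero has no mass there. *)
Definition cone (k : V) : bool :=
  [&& gap k.2 <= gap k.1, gap k.1 <= 1/16 & 0 < gap k.1].

(* Ping-pong: the shears by 4 and 8 map the cone to disjoint sets on which
   the second coordinate dominates. *)
Lemma mass_cone f :
  2 * \sum_(k | cone k) mass f k <=
  5/4 * \sum_(k | gap k.1 < gap k.2) mass f k
  + 400 * (m.+2 ^ 2)%:R * energy (shear 1) f.
Proof.
pose tau c (k : V) : V := (k.1, k.2 - c * k.1).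
have tauK c : cancel (tau c) (tau (- c)).
  by case=> x y; rewrite /tau /=; congr (_, _); ring.
have one_shear c : \sum_(k | cone k) mass f k <=
    5/4 * \sum_(k | cone (tau (- c) k)) mass f k
    + 5 * ((m.+2 ^ 2)%:R * energy (shear c) f).
  rewrite -parseval [X in 5/4 * X](reindex_inj (can_inj (tauK c))) /=.
  under [X in 5/4 * X]eq_bigl do rewrite tauK.
  rewrite mulr_sumr mulr_sumr.
  apply: (@le_trans _ _ (\sum_(k | cone k) 5/4 * mass f (tau c k)
      + \sum_(k | cone k) 5 * mass (fun v => f (shear c v) - f v) k)).
    by rewrite -big_split; apply: ler_sum => k _; exact: mass_diff_shear.
  rewrite lerD2l [leLHS]big_mkcond; apply: ler_sum => k _.
  by case: ifP => // _; apply: mulr_ge0 => //; apply: mass_ge0.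
have disj : \sum_(k | cone (tau (- 4) k)) mass f k
    + \sum_(k | cone (tau (- 8) k)) mass f k
    <= \sum_(k | gap k.1 < gap k.2) mass f k.
  rewrite [leRHS]big_mkcond [X in X + _]big_mkcond [X in _ + X]big_mkcond.
  rewrite -big_split /=.
  apply: ler_sum => -[a b] _; rewrite /cone /tau /= !mulNr !opprK.
  have M0 := mass_ge0 f (a, b).
  case: ifP => [/and3P[h1 h2 h3]|_].
    have /andP[-> g5] := gap_shear4 h1 h2 h3.
    case: ifP => [/and3P[h1' _ _]|_]; last by rewrite addr0.
    have := gap_shear8 h1' h2 h3; lra.
  case: ifP => [/and3P[h1 h2 h3]|_]; last by case: ifP => _; lra.
  have g5 := gap_shear8 h1 h2 h3.
  by rewrite ifT; lra.
have e2 := energy_shear_double f 1.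
have e4 := energy_shear_double f 2.
have e8 := energy_shear_double f 4.
have q2 : (1 + 1 : Z) = 2 by ring.
have q4 : (2 + 2 : Z) = 4 by ring.
have q8 : (4 + 4 : Z) = 8 by ring.
rewrite ?q2 ?q4 ?q8 in e2 e4 e8.
have o4 := one_shear 4; have o8 := one_shear 8.
set M := (_ ^ _)%:R in o4 o8 *.
have M0 : 0 <= M by exact: ler0n.
have f4 : M * energy (shear 4) f <= M * (16 * energy (shear 1) f).
  by apply: ler_wpM2l => //; lra.
have f8 : M * energy (shear 8) f <= M * (64 * energy (shear 1) f).
  by apply: ler_wpM2l => //; lra.
lra.
Qed.

(** Translation multiplies the coefficient at [k] by [chr (- k.1)], so the mass of the difference is
    [gap k.1 ^+ 2] times that of [f]; 256 is 16 squared. *)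
Lemma mass_inc f :
  \sum_(k : V | 1/16 < gap k.1) mass f k
  <= 256 * (m.+2 ^ 2)%:R * energy (act (Some (false, false))) f.
Proof.
rewrite -mulrA -parseval mulr_sumr big_mkcond; apply: ler_sum => k _.
rewrite /mass hatB hat_inc.
have -> : chr (- k.1) * hat f k - hat f k = - (1 - chr (- k.1)) * hat f k by ring.
rewrite nmM nmN -/(gap _) gapN.
case: ifP => [h|_]; last by rewrite mulr_ge0 // sqr_ge0.
rewrite exprMn mulrA ler_peMl ?sqr_ge0 //.
nra.
Qed.

End Fourier.

Section SpectralGap.

Variable m : nat.
Local Notation Z := 'I_m.+2.
Local Notation V := ('I_m.+2 * 'I_m.+2)%type.

Lemma energy_swap (T T' : V -> V) (f : V -> algR) :
    (forall v, T' (v.2, v.1) = ((T v).2, (T v).1)) ->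
  energy T (fun v => f (v.2, v.1)) = energy T' f.
Proof.
move=> TT'; rewrite /energy [RHS](reindex_inj (inv_inj (@swapK _))) /=.
by apply: eq_bigr => v _; rewrite TT'.
Qed.

(** Applied to [f] and to its coordinate swap, the ping-pong bounds the mass of both cones by 5/8 of
    the total plus energies, because the two target regions are disjoint. The remaining 3/8 is paid
    by energies with factors at most 256, and 8/3 * 256 < 700. *)
Lemma norm_le_energy (f : V -> algR) : \sum_v f v = 0 ->
  \sum_v f v ^+ 2 <= 700 * (energy (act (Some (false, false))) f
    + energy (act (Some (false, true))) f
    + energy (act (Some (true, false))) f
    + energy (act (Some (true, true))) f).
Proof.
move=> f0; have [w w_prim] := C_prim_root_exists (ltn0Sn m.+1).
pose M : algR := (m.+2 ^ 2)%:R.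
have M0 : 0 < M by rewrite ltr0n expn_gt0.
pose f' (v : V) := f (v.2, v.1).
have mass_swap k : mass w f' k = mass w f (k.2, k.1).
  by rewrite /mass hat_swap.
have massK : \sum_k mass w f k = M * \sum_v f v ^+ 2 by apply: parseval.
have cone1 := mass_cone w_prim f; have cone2 := mass_cone w_prim f'.
have inc1 := mass_inc w_prim f; have inc2 := mass_inc w_prim f'.
have lin1 : energy (shear 1) f = energy (act (Some (true, false))) f.
  by apply: eq_bigr => v _; rewrite /shear mul1r.
have lin2 : energy (shear 1) f' = energy (act (Some (true, true))) f.
  by apply: energy_swap => v; rewrite /shear mul1r.
have tr2 : energy (act (Some (false, false))) f'
    = energy (act (Some (false, true))) f.
  by apply: energy_swap => v.
rewrite lin1 -/M in cone1; rewrite lin2 -/M in cone2.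
rewrite -/M in inc1; rewrite tr2 -/M in inc2.
have swap_sum (P : pred V) : \sum_(k | P k) mass w f' k
    = \sum_(k : V | P (k.2, k.1)) mass w f k.
  rewrite (reindex_inj (inv_inj (@swapK _))) /=.
  by apply: eq_bigr => -[a b] _; rewrite mass_swap.
rewrite !swap_sum /= in cone2 inc2.
have cover : \sum_k mass w f k <=
    \sum_(k | cone w k) mass w f k
    + \sum_(k : V | cone w (k.2, k.1)) mass w f k
    + \sum_(k : V | 1/16 < gap w k.1) mass w f k
    + \sum_(k : V | 1/16 < gap w k.2) mass w f k.
  rewrite [X in _ <= X + _ + _ + _]big_mkcond.
  rewrite [X in _ <= _ + X + _ + _]big_mkcond.
  rewrite [X in _ <= _ + _ + X + _]big_mkcond.
  rewrite [X in _ <= _ + _ + _ + X]big_mkcond.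
  rewrite -!big_split /=; apply: ler_sum => -[a b] _ /=.
  have M0' := mass_ge0 w f (a, b).
  case: (ltP (1/16) (gap w a)) => ha.
    by rewrite addrAC lerDr !addr_ge0 //; case: ifP.
  case: (ltP (1/16) (gap w b)) => hb.
    by rewrite lerDr !addr_ge0 //; case: ifP.
  rewrite !addr0 /cone /= ha hb /=.
  have [a_b|b_a] := leP (gap w a) (gap w b).
    have [b0|] := ltP 0 (gap w b).
      by rewrite lerDr; case: ifP.
    move=> b0; have/eqP : gap w b <= 0 by [].
    have gb : gap w b = 0 by apply/le_anti; rewrite b0 gap_ge0.
    have ga : gap w a = 0 by apply/le_anti; rewrite gap_ge0 andbT -gb.
    (* Only the origin escapes both cones and both far regions; its coefficient is the sum of
       [f]. *)
    have -> : mass w f (a, b) = 0.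
      rewrite (gap_eq0 w_prim ga) (gap_eq0 w_prim gb) /mass /hat.
      under eq_bigr do rewrite !mul0r addr0 chr0 mulr1.
      rewrite -rmorph_sum f0 rmorph0 expr2.
      have -> : nm 0 = 0 by apply/val_inj; rewrite /= normr0.
      by rewrite mul0r.
    by rewrite !if_same addr0.
  rewrite (ltW b_a) (le_lt_trans (gap_ge0 w b) b_a) /=.
  by rewrite addr0.
have disj : \sum_(k : V | gap w k.1 < gap w k.2) mass w f k
    + \sum_(k : V | gap w k.2 < gap w k.1) mass w f k
    <= \sum_k mass w f k.
  rewrite [X in X + _]big_mkcond [X in _ + X]big_mkcond -big_split /=.
  apply: ler_sum => k _; have M0' := mass_ge0 w f k.
  by case: ltgtP => _; rewrite ?addr0 ?add0r.
have E1 := energy_ge0 (act (Some (false, false))) f.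
have E2 := energy_ge0 (act (Some (false, true))) f.
have E3 := energy_ge0 (act (Some (true, false))) f.
have E4 := energy_ge0 (act (Some (true, true))) f.
rewrite -(ler_pM2l M0) -massK.
move: (energy (act (Some (false, false))) f) E1 inc1 => e1 E1 inc1.
move: (energy (act (Some (false, true))) f) E2 inc2 => e2 E2 inc2.
move: (energy (act (Some (true, false))) f) E3 cone1 => e3 E3 cone1.
move: (energy (act (Some (true, true))) f) E4 cone2 => e4 E4 cone2.
have Me1 := mulr_ge0 (ltW M0) E1.
have Me2 := mulr_ge0 (ltW M0) E2.
have Me3 := mulr_ge0 (ltW M0) E3.
have Me4 := mulr_ge0 (ltW M0) E4.
lra.
Qed.

Definition norm2 (f : V -> algR) : algR := \sum_v f v ^+ 2.

Lemma norm2_act o f : norm2 (fun v => f (act o v)) = norm2 f.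
Proof. by rewrite /norm2 [RHS](reindex_inj (@act_inj m o)). Qed.

Lemma sum_step (F : step -> algR) : \sum_o F o =
  F None + F (Some (false, false)) + F (Some (false, true))
  + F (Some (true, false)) + F (Some (true, true)).
Proof.
rewrite (bigD1 None) //= -!addrA; congr (_ + _).
rewrite (reindex_omap Some id) /=; last by case.
rewrite (eq_bigl xpredT); last by move=> o; rewrite eqxx.
have -> : \sum_p F (Some p) = \sum_a \sum_b F (Some (a, b)).
  by rewrite pair_bigA; apply: eq_bigr => -[].
by rewrite !big_bool /=; ring.
Qed.

(** The square of a sum of five terms is 5 times the sum of their squares minus the squares of all
    pairwise differences. Keeping the four differences that involve the identity gives the
    energies. *)
Lemma walk_contract (f : V -> algR) : \sum_v f v = 0 ->
  norm2 (fun v => \sum_o f (act o v)) <= (25 - 1/700) * norm2 f.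
Proof.
move=> f0; have E := norm_le_energy f0; rewrite -/(norm2 f) in E.
have N o := norm2_act o f.
suff : norm2 (fun v => \sum_o f (act o v)) <= 5 * \sum_o norm2 (fun v => f (act o v))
   - (energy (act (Some (false, false))) f
    + energy (act (Some (false, true))) f
    + energy (act (Some (true, false))) f
    + energy (act (Some (true, true))) f).
  rewrite (eq_bigr (fun=> norm2 f)) // sum_step; lra.
rewrite sum_step /norm2 /energy -!big_split /= mulr_sumr -sumrB.
apply: ler_sum => v _; rewrite sum_step /=.
set a := f v; set b := f _; set c := f _; set d := f _; set e := f _.
have := sqr_ge0 (b - c); have := sqr_ge0 (b - d); have := sqr_ge0 (b - e).
have := sqr_ge0 (c - d); have := sqr_ge0 (c - e); have := sqr_ge0 (d - e).
lra.
Qed.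

End SpectralGap.

(** * Words of steps and mixing of the walk *)

Definition actw (m : nat) (w : seq step) (v : 'I_m.+2 * 'I_m.+2) :=
  foldl (fun v o => act o v) v w.

Lemma actw_inj (m : nat) (w : seq step) : injective (@actw m w).
Proof. by elim: w => [|o w IHw] // u v /= /IHw /act_inj. Qed.

Lemma actw_cat (m : nat) (w1 w2 : seq step) (v : 'I_m.+2 * 'I_m.+2) :
  actw (w1 ++ w2) v = actw w2 (actw w1 v).
Proof. exact: foldl_cat. Qed.

(** An explicit list, so that a label, being a number, selects its word by position. *)
Fixpoint words (n : nat) : seq (seq step) :=
  if n is n'.+1 then [seq o :: w | o <- enum {: step}, w <- words n']
  else [:: [::]].

Lemma size_words n : size (words n) = (5 ^ n)%N.
Proof.
elim: n => // n IHn /=; rewrite size_allpairs IHn -cardT expnS.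
by rewrite card_option card_prod card_bool.
Qed.

Lemma size_word n w : w \in words n -> size w = n.
Proof.
elim: n w => [|n IHn] w; first by rewrite inE => /eqP ->.
by move=> /allpairsP[[o w'] [_ /IHn /= <- ->]].
Qed.

Lemma sum_wordsS (T : nmodType) n (F : seq step -> T) :
  \sum_(w <- words n.+1) F w = \sum_o \sum_(w <- words n) F (o :: w).
Proof. by rewrite /= big_allpairs_dep big_enum. Qed.

Lemma sum_words_cat (T : nmodType) n1 n2 (F : seq step -> T) :
  \sum_(w <- words (n1 + n2)) F w
  = \sum_(w1 <- words n1) \sum_(w2 <- words n2) F (w1 ++ w2).
Proof.
elim: n1 F => [|n1 IHn1] F; first by rewrite big_seq1.
by rewrite addSn !sum_wordsS; apply: eq_bigr => o _; rewrite IHn1.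
Qed.

Lemma bernoulli (R : realFieldType) (x : R) n : 0 <= x ->
  1 + n%:R * x <= (1 + x) ^+ n.
Proof.
move=> x0; elim: n => [|n IHn]; first by rewrite mul0r addr0 expr0.
rewrite exprS -natr1; apply: le_trans (_ : (1 + x) * (1 + n%:R * x) <= _).
  have : 0 <= n%:R * x * x by rewrite !mulr_ge0.
  by lra.
by apply: ler_wpM2l => //; lra.
Qed.

(** With x = (b - a) / b one has (1 + x) a <= b without dividing by [a], which may vanish; Bernoulli
    makes (1 + x) ^ p exceed [c]. *)
Lemma geometric_decay (R : archiRealFieldType) (a b c : R) : 0 <= a < b -> 0 <= c ->
  exists p0, forall p, (p0 <= p)%N -> c * a ^+ p <= b ^+ p.
Proof.
move=> /andP[a0 ab] c0; have b0 := le_lt_trans a0 ab.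
pose x := (b - a) / b; have x0 : 0 < x by rewrite divr_gt0 // subr_gt0.
have y0 : 0 <= c / x by rewrite divr_ge0 // ltW.
exists (Num.bound (c / x)) => p le_p.
have lt_c : c <= (1 + x) ^+ p.
  apply: le_trans (bernoulli p (ltW x0)); rewrite -lerBlDl.
  apply: (@le_trans _ _ c); first by rewrite gerBl.
  rewrite -ler_pdivrMr // ltW //; apply: lt_le_trans (archi_boundP y0) _.
  by rewrite ler_nat.
have le_b : (1 + x) * a <= b.
  rewrite -subr_ge0; have -> : b - (1 + x) * a = (b - a) ^+ 2 / b.
    by rewrite /x; field; rewrite lt0r_neq0.
  by rewrite divr_ge0 ?sqr_ge0 ?ltW.
apply: (@le_trans _ _ ((1 + x) ^+ p * a ^+ p)).
  by apply: ler_wpM2r => //; apply: exprn_ge0.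
by rewrite -exprMn lerXn2r // nnegrE ?mulr_ge0 // ltW // addr_gt0.
Qed.

Section Mixing.

Variable m : nat.
Local Notation V := ('I_m.+2 * 'I_m.+2)%type.

Definition wsum p (f : V -> algR) (v : V) := \sum_(w <- words p) f (actw w v).

Lemma wsumS p f v : wsum p.+1 f v = \sum_o wsum p f (act o v).
Proof. exact: sum_wordsS. Qed.

Lemma sum_wsum p f : \sum_v f v = 0 -> \sum_v wsum p f v = 0.
Proof.
move=> f0; rewrite exchange_big big1_seq //= => w _.
by rewrite -[RHS]f0 [RHS](reindex_inj (@actw_inj m w)).
Qed.

Lemma norm2_wsum p f : \sum_v f v = 0 ->
  norm2 (wsum p f) <= (25 - 1/700) ^+ p * norm2 f.
Proof.
move=> f0; elim: p => [|p IHp].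
  rewrite expr0 mul1r; apply: ler_sum => v _.
  by rewrite /wsum big_seq1.
have := walk_contract (sum_wsum p f0).
have -> : norm2 (wsum p.+1 f)
    = norm2 (fun v => \sum_o wsum p f (act o v)).
  by apply: eq_bigr => v _; rewrite wsumS.
move=> /le_trans; apply.
by rewrite exprS -mulrA ler_pM2l //; lra.
Qed.

(** The deviation from the expected count is summed over [A] by x <= theta / 2 + x^2 / (2 theta).
    The free parameter replaces Cauchy-Schwarz and avoids square roots. *)
Lemma mixing_bound p (A B : {set V}) (theta : algR) : 0 < theta ->
  (\sum_(w <- words p) #|[set v in A | actw w v \in B]|)%:R
  <= 5 ^+ p * (#|A|%:R * #|B|%:R / (m.+2 ^ 2)%:R) + #|A|%:R * (theta / 2)
     + (25 - 1/700) ^+ p * #|B|%:R / (theta * 2) :> algR.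
Proof.
move=> theta0; set n : algR := (m.+2 ^ 2)%:R.
have n0 : 0 < n by rewrite ltr0n expn_gt0.
pose b : algR := #|B|%:R / n; pose f (v : V) : algR := (v \in B)%:R - b.
have sumB : \sum_(v : V) (v \in B)%:R = #|B|%:R :> algR.
  by rewrite -natr_sum -big_mkcond sum1_card.
have sumc (c : algR) : \sum_(v : V) c = n * c.
  by rewrite sumr_const card_prod card_ord mulnn mulr_natl.
have f0 : \sum_v f v = 0.
  rewrite sumrB sumB sumc /b mulrC divfK ?subrr //.
  exact: lt0r_neq0.
have f2 : norm2 f <= #|B|%:R.
  have -> : norm2 f = \sum_(v : V) ((v \in B)%:R - 2 * b * f v - b ^+ 2).
    apply: eq_bigr => v _; rewrite /f; case: (v \in B) => /=; ring.
  rewrite !sumrB sumB -mulr_sumr f0 mulr0 subr0 sumc.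
  by have := mulr_ge0 (sqr_ge0 b) (ltW n0); lra.
have sum_words_const (c : algR) : \sum_(w <- words p) c = 5 ^+ p * c.
  by rewrite big_const_seq count_predT iter_addr_0 size_words -natrX mulr_natl.
have -> : (\sum_(w <- words p) #|[set v in A | actw w v \in B]|)%:R
    = \sum_(v in A) (wsum p f v + 5 ^+ p * b).
  under [RHS]eq_bigr => v _.
    rewrite /wsum sumrB sum_words_const subrK.
  over.
  rewrite exchange_big natr_sum /=; apply: eq_bigr => w _.
  rewrite -sum1_card natr_sum big_mkcond [RHS]big_mkcond.
  by apply: eq_bigr => v _; rewrite inE; case: (v \in A); case: (_ \in B).
rewrite big_split /= sumr_const.
have -> : 5 ^+ p * b *+ #|A| = 5 ^+ p * (#|A|%:R * #|B|%:R / n).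
  by rewrite -mulr_natr /b; ring.
rewrite [leLHS]addrC -addrA lerD2l.
apply: (@le_trans _ _ (\sum_(v in A) (theta / 2 + wsum p f v ^+ 2 / (theta * 2)))).
  apply: ler_sum => v _; set x := wsum p f v.
  rewrite -subr_ge0.
  have -> : theta / 2 + x ^+ 2 / (theta * 2) - x = (x - theta) ^+ 2 / (theta * 2).
    by field; rewrite ?lt0r_neq0.
  by rewrite divr_ge0 ?sqr_ge0 //; lra.
rewrite big_split /= sumr_const -[theta / 2 *+ _]mulr_natl lerD2l -mulr_suml.
apply: ler_wpM2r; first by rewrite invr_ge0; lra.
apply: (@le_trans _ _ (norm2 (wsum p f))).
  rewrite big_mkcond; apply: ler_sum => v _.
  by case: ifP => // _; apply: sqr_ge0.
apply: le_trans (norm2_wsum p f0) _; apply: ler_wpM2l => //.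
by apply: exprn_ge0; lra.
Qed.

End Mixing.

(** It matters that [p0] depends on [q] alone: one walk length serves all moduli. *)
Lemma expander_mixing (q : nat) : (0 < q)%N ->
  exists p0 : nat, forall p, (p0 <= p)%N ->
  forall (m : nat) (A B : {set 'I_m.+2 * 'I_m.+2}) (tau : nat),
    (#|A| <= tau)%N -> (#|B| <= tau)%N -> (2 * q * tau <= m.+2 ^ 2)%N ->
    (q * (\sum_(w <- words p) #|[set v in A | actw w v \in B]|)
     <= 5 ^ p * tau)%N.
Proof.
move=> q0; pose Q : algR := q%:R.
have Q0 : 0 < Q by rewrite ltr0n.
have Q2 : 0 <= 4 * Q ^+ 2 by rewrite mulr_ge0 ?sqr_ge0.
have [|p0 decay] := @geometric_decay algR (25 - 1/700) 25 (4 * Q ^+ 2) _ Q2.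
  by apply/andP; split; lra.
exists p0 => p /decay {}decay m A B tau leA leB le_tau.
pose a : algR := 25 - 1/700; rewrite -/a in decay.
have a0 : 0 <= a ^+ p by apply: exprn_ge0; rewrite /a; clear; lra.
pose P : algR := 5 ^+ p; have P0 : 0 < P by rewrite exprn_gt0.
pose t : algR := tau%:R; have t0 : 0 <= t by exact: ler0n.
set S := bigop _ _ _.
have Q20 : 0 < 2 * Q by apply: mulr_gt0.
(* With theta = P / (2 Q) the three terms of the bound are at most 1/2, 1/4 and 1/4 of P t / Q. *)
have theta0 : 0 < P / (2 * Q) by apply: divr_gt0.
have := mixing_bound p A B theta0; rewrite -/S -/a => bound.
rewrite -(ler_nat algR) !natrM natrX -/Q -/P -/t.
have la : #|A|%:R <= t by rewrite ler_nat.
have lb : #|B|%:R <= t by rewrite ler_nat.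
have n0 : 0 < (m.+2 ^ 2)%:R :> algR by rewrite ltr0n expn_gt0.
have lt : 2 * Q * t <= (m.+2 ^ 2)%:R by rewrite /Q /t -!natrM ler_nat.
set n : algR := (_ ^ _)%:R in bound n0 lt.
have b1 : #|A|%:R * #|B|%:R / n <= t / (2 * Q).
  rewrite ler_pdivrMr // mulrAC ler_pdivlMr //.
  apply: (@le_trans _ _ (t * t * (2 * Q))).
    by apply: ler_wpM2r; [apply: ltW | apply: ler_pM].
  by rewrite -mulrA; apply: ler_wpM2l => //; rewrite mulrC.
have b2 : #|A|%:R * (P / (2 * Q) / 2) <= t * P / (4 * Q).
  have -> : t * P / (4 * Q) = t * (P / (2 * Q) / 2).
    by field; rewrite lt0r_neq0.
  by apply: ler_wpM2r => //; rewrite divr_ge0 // ltW.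
have b3 : a ^+ p * #|B|%:R / (P / (2 * Q) * 2) <= t * P / (4 * Q).
  have -> : P / (2 * Q) * 2 = P / Q by field; rewrite lt0r_neq0.
  rewrite ler_pdivrMr; last by apply: divr_gt0.
  have -> : t * P / (4 * Q) * (P / Q) = (P ^+ 2 / (4 * Q ^+ 2)) * t.
    by field; rewrite lt0r_neq0.
  have d : a ^+ p <= P ^+ 2 / (4 * Q ^+ 2).
    rewrite ler_pdivlMr; last by apply: mulr_gt0 => //; apply: exprn_gt0.
    have -> : P ^+ 2 = 25 ^+ p.
      by rewrite /P -exprM mulnC exprM; congr (_ ^+ p); ring.
    by rewrite mulrC.
  by apply: ler_pM.
have b4 : P * (#|A|%:R * #|B|%:R / n) <= P * (t / (2 * Q)).
  by rewrite ler_pM2l.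
have -> : P * t = Q * (P * (t / (2 * Q)) + t * P / (4 * Q) + t * P / (4 * Q)).
  by field; rewrite lt0r_neq0.
rewrite ler_pM2l //; apply: (le_trans bound).
by rewrite !lerD.
Qed.

(** * Gadgets of constant size *)

Section Gadget.
Local Open Scope nat_scope.

Lemma prod_ord_const n k : \prod_(i < k) n = n ^ k.
Proof. by rewrite prod_nat_const card_ord. Qed.

(** A crude Stirling bound with 4 in place of e: k ^ k is at most the falling factorial of 2 k,
    which is a central binomial coefficient times k!. *)
Lemma expn_self_le k : k ^ k <= 4 ^ k * k`!.
Proof.
have le_ffact : k ^ k <= (2 * k) ^_ k.
  rewrite ffact_prod -prod_ord_const.
  by apply: leq_prod => i _; have := ltn_ord i; lia.
have le_bin : 'C(2 * k, k) <= 4 ^ k.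
  have lt_k : k < (2 * k).+1 by lia.
  rewrite -(expnM 2 2) -[2]/(1 + 1) expnDn (bigD1 (Ordinal lt_k)) //=.
  by rewrite !exp1n !muln1 leq_addr.
by apply: leq_trans le_ffact _; rewrite -bin_ffact leq_mul2r le_bin orbT.
Qed.

Lemma bin_exp_le n k : 'C(n, k) * k ^ k <= 4 ^ k * n ^ k.
Proof.
apply: leq_trans (_ : 'C(n, k) * (4 ^ k * k`!) <= _).
  by rewrite leq_mul2l expn_self_le orbT.
rewrite mulnCA leq_mul2l bin_ffact ffact_prod.
by rewrite -(prod_ord_const n k) leq_prod ?orbT // => i _; apply: leq_subr.
Qed.

Lemma bin_ratio y M d : y <= M -> 'C(y, d) * M ^ d <= 'C(M, d) * y ^ d.
Proof.
move=> yM; rewrite -(leq_pmul2r (fact_gt0 d)) mulnAC [leqRHS]mulnAC.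
rewrite !bin_ffact !ffact_prod -(prod_ord_const M d) -(prod_ord_const y d).
rewrite -!big_split /=.
by apply: leq_prod => i _; rewrite !mulnBl; nia.
Qed.

(** The partial sum up to j is at most X (1 - 2 ^ (- j)), an invariant stated without division in
    the induction. *)
Lemma geometric_sum_lt (a : nat -> nat) (X n : nat) : 0 < X ->
  (forall s, 0 < s <= n -> a s * 2 ^ s <= X) ->
  \sum_(1 <= s < n.+1) a s < X.
Proof.
move=> X0 le_a.
have : forall j, j <= n ->
    (\sum_(1 <= s < j.+1) a s) * 2 ^ j + X <= X * 2 ^ j.
  elim=> [|j IHj] le_j; first by rewrite big_geq // expn0 !muln1.
  rewrite big_nat_recr //= mulnDl.
  have := IHj (ltnW le_j); have := le_a j.+1; rewrite le_j => /(_ isT).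
  rewrite expnS; move: (2 ^ j) (a j.+1) (\sum_(1 <= s < j.+1) a s) => P b c; nia.
move=> /(_ n (leqnn n)); have : 0 < 2 ^ n by rewrite expn_gt0.
move: (2 ^ n) (\sum_(_ <= _ < _) _) => P b; nia.
Qed.

Lemma union_bound_size d g D M s : 2 <= d -> 0 < g ->
  D <= g * M -> s * (8 * 4 ^ d * d ^ 2 * g ^ 2) <= D -> (d - 2) * s <= M.
Proof.
move=> d2 g0 leD les.
have sD : s * d * g <= D.
  apply: leq_trans les; rewrite -mulnA leq_mul2l; apply/orP; right.
  have := expn_gt0 4 d; move: (4 ^ d) => P P0.
  rewrite -(mulnA (8 * P)) -[X in X <= _]mul1n leq_mul //; first by lia.
  by rewrite leq_mul // -mulnn leq_pmulr //; lia.
have : s * d <= M by rewrite -(leq_pmul2l g0); lia.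
by apply: leq_trans; rewrite mulnC leq_mul2l leq_subr orbT.
Qed.

Lemma exists_superset (T : finType) (A : {set T}) k : #|A| <= k <= #|T| ->
  exists2 B : {set T}, A \subset B & #|B| = k.
Proof.
move=> /andP[Ak kT].
have /card_gt0P[B] : 0 < #|[set B : {set T} | B \subset ~: A & #|B| == k - #|A|]|.
  by rewrite cards_draws bin_gt0 (cardsCs (~: A)) setCK leq_sub2r.
rewrite inE => /andP[BA /eqP cB]; exists (A :|: B); first exact: subsetUl.
rewrite cardsU cB disjoint_setI0 ?cards0 ?subn0 ?subnKC //.
by rewrite disjoint_sym disjoints_subset.
Qed.

(** Giving up two neighbours per label leaves a surplus factor (y / M) ^ (2 s) with y = (d - 2) s.
    It beats the roughly (D / s) ^ s choices of a label set; giving up one would only balance them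
    up to a constant to the power s. *)
Lemma union_bound_term d g D M s : 2 <= d -> 0 < g -> 0 < s -> 0 < M ->
  D <= g * M -> s * (8 * 4 ^ d * d ^ 2 * g ^ 2) <= D ->
  'C(D, s) * 'C(M, (d - 2) * s) * 'C((d - 2) * s, d) ^ s * 2 ^ s
  <= 'C(M, d) ^ s.
Proof.
move=> d2 g0 s0 M0 leD les.
have yM := union_bound_size d2 g0 leD les.
set y := (d - 2) * s in yM *.
have ds : d * s = y + 2 * s by rewrite /y -mulnDl subnK.
(* Since d s = y + 2 s, the factor (y / M) ^ y cancels the choices of the target set up to 4 ^ y.
   What remains is an s-th power, controlled by y <= d s and D <= g M; this dictates 8 * 4 ^ d * d ^
   2 * g ^ 2. *)
have key : 4 ^ s * D ^ s * 4 ^ y * y ^ (2 * s) * 2 ^ s <= s ^ s * M ^ (2 * s).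
  rewrite /y (expnM 4) (expnM _ 2) (expnM M) -!expnMn leq_exp2r //.
  rewrite -/y -(leq_pmul2r (_ : 0 < g ^ 2)) ?expn_gt0 ?g0 //.
  have yd : y <= d * s by rewrite leq_mul2r leq_subr orbT.
  have d4 : 4 ^ (d - 2) <= 4 ^ d by rewrite leq_pexp2l // leq_subr.
  apply: (@leq_trans (4 * D * 4 ^ d * (d * s) ^ 2 * 2 * g ^ 2)).
    by rewrite !leq_mul // leq_subr.
  apply: (@leq_trans (s * D * (s * (8 * 4 ^ d * d ^ 2 * g ^ 2)))).
    by rewrite expnMn; apply/eq_leq; ring.
  apply: (@leq_trans (s * D * D)); first by rewrite leq_mul2l les orbT.
  apply: (@leq_trans (s * (g * M) * (g * M))); first by rewrite !leq_mul.
  by apply/eq_leq; ring.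
have P0 : 0 < s ^ s * M ^ (d * s) by rewrite muln_gt0 !expn_gt0 s0 M0.
rewrite -(leq_pmul2r P0).
have h1 := bin_exp_le D s.
have h2 := bin_exp_le M y.
have h3 : 'C(y, d) ^ s * M ^ (d * s) <= 'C(M, d) ^ s * y ^ (d * s).
  by rewrite !expnM -!expnMn leq_exp2r // bin_ratio.
have h := leq_mul (leq_mul h1 h2) h3.
rewrite ds (expnD M) (expnD y) in h; rewrite ds (expnD M).
rewrite -(leq_pmul2r (_ : 0 < y ^ y)); last first.
  by rewrite expn_gt0; case: (y).
move: h key.
move: ('C(D, s)) ('C(M, y)) ('C(y, d) ^ s) ('C(M, d) ^ s) => A B E F.
move: (s ^ s) (y ^ y) (y ^ (2 * s)) (M ^ y) (M ^ (2 * s)) (4 ^ s) (4 ^ y)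
  (D ^ s) (2 ^ s) => ss yy y2 My M2 s4 y4 Ds s2 h key.
apply: (@leq_trans (s2 * (A * ss * (B * yy) * (E * (My * M2))))).
  by apply/eq_leq; ring.
apply: leq_trans (_ : s2 * (s4 * Ds * (y4 * My) * (F * (yy * y2))) <= _).
  by rewrite leq_mul2l h orbT.
apply: (@leq_trans (F * My * yy * (s4 * Ds * y4 * y2 * s2))).
  by apply/eq_leq; ring.
apply: (@leq_trans (F * My * yy * (ss * M2))).
  by rewrite leq_mul2l key orbT.
by apply/eq_leq; ring.
Qed.

(** A map failing on S sends it into some set of exactly (d - 2) |S| points, so the union bound
    ranges over pairs of sets of prescribed sizes. *)
Lemma gadget_exists d g : 2 <= d -> 0 < g -> exists2 z, 0 < z &
  forall D M, D <= g * M -> d <= M ->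
  exists h : 'I_D -> {set 'I_M},
    (forall l, #|h l| = d) /\
    forall S : {set 'I_D}, #|S| * z <= D ->
      (d - 2) * #|S| <= #|\bigcup_(l in S) h l|.
Proof.
move=> d2 g0; exists (8 * 4 ^ d * d ^ 2 * g ^ 2).
  by rewrite !muln_gt0 !expn_gt0 g0 /=; lia.
set z := 8 * _ * _ * _ => D M leD dM.
have z0 : 0 < z by rewrite !muln_gt0 !expn_gt0 g0 /=; lia.
have M0 : 0 < M by lia.
pose draws (Y : {set 'I_M}) := [set A : {set 'I_M} | A \subset Y & #|A| == d].
have card_draws_in Y : #|draws Y| = 'C(#|Y|, d) by rewrite cards_draws.
pose F (p : {set 'I_D} * {set 'I_M}) : {pred {ffun 'I_D -> {set 'I_M}}} :=
  family (fun l => draws (if l \in p.1 then p.2 else setT)).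
have card_F p : #|F p| = 'C(#|p.2|, d) ^ #|p.1| * 'C(M, d) ^ (D - #|p.1|).
  rewrite card_family foldrE big_map big_enum /=.
  rewrite (bigID (mem p.1)) /=; congr (_ * _).
    rewrite (eq_bigr (fun=> 'C(#|p.2|, d))) ?prod_nat_const //.
    by move=> l ->; rewrite -card_draws_in.
  rewrite (eq_bigr (fun=> 'C(M, d))); last first.
    by move=> l /negPf ->; rewrite -[M in RHS]card_ord -cardsT -card_draws_in.
  rewrite (eq_bigl (mem (~: p.1))); last by move=> l; rewrite /= inE.
  by rewrite prod_nat_const (cardsCs (~: p.1)) setCK card_ord.
pose bad (p : {set 'I_D} * {set 'I_M}) :=
  [&& 0 < #|p.1|, #|p.1| * z <= D & #|p.2| == (d - 2) * #|p.1|].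
pose a s := if s * z <= D then 'C(D, s) * 'C(M, (d - 2) * s)
  * ('C((d - 2) * s, d) ^ s * 'C(M, d) ^ (D - s)) else 0.
have C0 : 0 < 'C(M, d) by rewrite bin_gt0.
have sum_bad : \sum_(p | bad p) #|F p| = \sum_(1 <= s < D.+1) a s.
  have -> : \sum_(1 <= s < D.+1) a s
      = \sum_(s < D.+1) if 0 < s then a s else 0.
    rewrite -(big_mkord xpredT (fun s => if 0 < s then a s else 0)).
    by rewrite [RHS]big_ltn // add0n; apply: eq_big_nat => s /andP[->].
  rewrite (partition_big (fun p : {set 'I_D} * {set 'I_M} =>
    inord #|p.1| : 'I_D.+1) xpredT) //=.
  apply: eq_bigr => s _.
  have le_card (A : {set 'I_D}) : #|A| < D.+1.
    by rewrite ltnS -[leqRHS](card_ord D) max_card.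
  pose X := setX [set A : {set 'I_D} | #|A| == s]
    [set Y : {set 'I_M} | #|Y| == (d - 2) * s].
  rewrite (eq_bigl (fun p => [&& 0 < s, s * z <= D & p \in X])); last first.
    move=> [A Y]; rewrite /bad inE /= !inE -(inj_eq val_inj) /= inordK //.
    case: (eqVneq #|A| s) => [->|_]; rewrite ?andbF // andbT.
    by rewrite !andTb.
  rewrite /a; case: (ltnP 0 s) => s0 /=; last by rewrite big1.
  case: ifP => les; last by rewrite big1.
  rewrite (eq_bigr (fun=> 'C((d - 2) * s, d) ^ s * 'C(M, d) ^ (D - s))).
    rewrite (eq_bigl (mem X)) // sum_nat_const; congr (_ * _).
    by rewrite cardsX !card_draws !card_ord.
  by move=> [A Y] /andP[_]; rewrite inE card_F /= !inE => /andP[/eqP-> /eqP->].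
(* For the pair of empty sets no label is constrained, so [F (set0, set0)] consists of all candidate
   maps. *)
have few : \sum_(p | bad p) #|F p| < #|F (set0, set0)|.
  rewrite sum_bad card_F /= !cards0 expn0 mul1n subn0.
  apply: geometric_sum_lt => [|s /andP[s0 sD]]; first by rewrite expn_gt0 C0.
  rewrite /a; case: ifP => // les.
  rewrite -[D in leqRHS](subnKC sD) expnD.
  have := union_bound_term d2 g0 s0 M0 leD les.
  by rewrite -(leq_pmul2r (_ : 0 < 'C(M, d) ^ (D - s))) ?expn_gt0 ?C0 //; lia.
have [f f_draws f_good] : exists2 f, f \in F (set0, set0) &
    forall p, bad p -> f \notin F p.
  have : ~~ [forall (f | f \in F (set0, set0)), [exists (p | bad p), f \in F p]].
    apply/negP => /forall_inP all_bad; move: few; rewrite ltnNge => /negP; apply.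
    rewrite -sum1_card; apply: (@leq_trans
      (\sum_(f in F (set0, set0)) \sum_(p | bad p) (f \in F p))).
      apply: leq_sum => f /all_bad /exists_inP[p badp fp].
      by rewrite (bigD1 p) //= fp leq_addr.
    rewrite exchange_big; apply: leq_sum => p _ /=.
    by rewrite -big_mkcondr sum1_card subset_leq_card //; apply/subsetP => f /andP[].
  rewrite negb_forall_in => /exists_inP[f fF]; rewrite negb_exists_in.
  by move=> /forall_inP good; exists f.
have f_card l : #|f l| = d.
  by have /familyP /(_ l) := f_draws; rewrite !inE => /andP[_ /eqP].
exists f; split=> [//|S leS]; rewrite leqNgt; apply/negP => small.
have S0 : 0 < #|S| by lia.
have le_M := union_bound_size d2 g0 leD leS.
have [|Y fSY cY] := @exists_superset _ (\bigcup_(l in S) f l) ((d - 2) * #|S|).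
  by rewrite card_ord le_M ltnW.
have bad_SY : bad (S, Y) by rewrite /bad S0 leS cY /=.
move/negP: (f_good _ bad_SY); apply.
apply/familyP => l; rewrite !inE f_card eqxx andbT.
case: ifP => [lS|_]; last exact: subsetT.
by apply: subset_trans fSY; apply: bigcup_sup.
Qed.

End Gadget.

(** * Lossless expansion *)

Section Routing.
Local Open Scope nat_scope.

Variables (V : finType) (k D M d z q : nat).
Variable route : 'I_D -> 'I_k -> V -> V.
Variable h : 'I_D -> {set 'I_M}.

Hypothesis route_inj : forall l a, injective (route l a).
Hypothesis h_expands : forall S : {set 'I_D}, #|S| * z <= D ->
  (d - 2) * #|S| <= #|\bigcup_(l in S) h l|.
Hypothesis route_mixing : forall (a b : 'I_k) (A B : {set V}) tau, a < b ->
  #|A| <= tau -> #|B| <= tau -> 2 * q * tau <= #|V| ->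
  q * #|[set u : V * 'I_D | (route u.2 a u.1 \in A) && (route u.2 b u.1 \in B)]|
  <= D * tau.
Hypothesis q_def : q = k ^ 3 * z.
Hypotheses (k0 : 0 < k) (z0 : 0 < z) (D0 : 0 < D).

Definition routed (u : V * 'I_D) : {set V * 'I_k * 'I_M} :=
  [set x | (x.1.1 == route u.2 x.1.2 u.1) && (x.2 \in h u.2)].

Lemma card_routed u : (forall l, #|h l| = d) -> #|routed u| = k * d.
Proof.
move=> hd; have <- : #|setX [set: 'I_k] (h u.2)| = k * d.
  by rewrite cardsX cardsT card_ord hd.
rewrite -(card_imset (f := fun x : 'I_k * 'I_M => ((route u.2 x.1 u.1, x.1), x.2))).
  apply: eq_card => -[[w a] r]; rewrite inE /=.
  apply/andP/imsetP => [[/eqP-> hr]|[[a' r'] + [-> -> ->]]].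
    by exists (a, r); rewrite // !inE.
  by rewrite !inE => /= ->.
by move=> [a r] [a' r'] [_ -> ->].
Qed.

Section Expansion.

Variable S : {set V * 'I_D}.
Hypothesis S_small : #|S| * (2 * q * z) <= #|V| * D.

Definition visitors (w : V) (a : 'I_k) : {set V * 'I_D} :=
  [set u in S | route u.2 a u.1 == w].

Definition fiber (w : V) (a : 'I_k) : {set 'I_D} :=
  [set u.2 | u in visitors w a].

Definition heavy (a : 'I_k) : {set V} := [set w | D < #|fiber w a| * z].

(** Routes are injective, so visitors of one block with the same label coincide; the gadget
    therefore sees them as distinct labels. *)
Lemma card_fiber w a : #|fiber w a| = #|visitors w a|.
Proof.
rewrite card_in_imset // => -[v l] [v' l']; rewrite !inE /=.
move=> /andP[_ /eqP e] /andP[_ /eqP e'] ll'; subst l'.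
by rewrite -e' in e; rewrite (route_inj e).
Qed.

Lemma sum_visitors a (P : pred V) :
  \sum_(w | P w) #|visitors w a| = #|[set u in S | P (route u.2 a u.1)]|.
Proof.
rewrite -sum1_card (partition_big (fun u => route u.2 a u.1) P) /=; last first.
  by move=> u; rewrite inE => /andP[].
apply: eq_bigr => w Pw; rewrite -sum1_card; apply: eq_bigl => u.
rewrite !inE -andbA; case: (u \in S) => //=.
by case: eqVneq => [->|]; rewrite ?Pw ?andbF.
Qed.

Let tau := (z * #|S|) %/ D.

(** Markov's inequality: a heavy block has more than D / z visitors, and each element of [S] visits
    one block at time [a]. *)
Lemma card_heavy a : #|heavy a| <= tau.
Proof.
rewrite leq_divRL // -sum_nat_const.
apply: (@leq_trans (\sum_(w in heavy a) #|visitors w a| * z)).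
  by apply: leq_sum => w; rewrite inE -card_fiber => /ltnW.
rewrite -big_distrl /= sum_visitors mulnC leq_mul2l subset_leq_card ?orbT //.
by apply/subsetP => u; rewrite inE => /andP[].
Qed.

Lemma tau_small : 2 * q * tau <= #|V|.
Proof.
rewrite -(leq_pmul2r D0) -mulnA; apply: leq_trans S_small.
have := leq_divM (z * #|S|) D; rewrite -/tau => le_tau.
apply: (@leq_trans (2 * q * (z * #|S|))); first by rewrite leq_mul2l le_tau orbT.
by apply/eq_leq; ring.
Qed.

Definition doubly_heavy (a b : 'I_k) : {set V * 'I_D} :=
  [set u | (route u.2 a u.1 \in heavy a) && (route u.2 b u.1 \in heavy b)].

(** The factor k ^ 3 pays for at most k ^ 2 pairs of times and for a load of at most k. *)
Lemma card_doubly_heavy (a b : 'I_k) : a < b -> k ^ 3 * #|doubly_heavy a b| <= #|S|.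
Proof.
move=> ab; have := route_mixing ab (card_heavy a) (card_heavy b) tau_small.
rewrite -/(doubly_heavy a b) q_def => le.
rewrite -(leq_pmul2r z0); apply: leq_trans (_ : D * tau <= _).
  by apply: leq_trans le; apply/eq_leq; ring.
by rewrite mulnC [leqRHS]mulnC leq_divM.
Qed.

Definition load (u : V * 'I_D) : nat := #|[set a | route u.2 a u.1 \in heavy a]|.

Lemma load_le u :
  load u <= 1 + k * \sum_(p : 'I_k * 'I_k | p.1 < p.2) (u \in doubly_heavy p.1 p.2).
Proof.
case: (leqP (load u) 1) => [le1|]; first exact: (leq_trans le1 (leq_addr _ _)).
move=> /card_gt1P[a [b [aH bH ab]]].
wlog lt_ab : a b aH bH ab / a < b => [th|].
  have [/th|/th|/val_inj ab'] := ltngtP a b; [exact|apply=> //; by rewrite eq_sym|].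
  by rewrite ab' eqxx in ab.
have le_k : load u <= k by rewrite -[leqRHS]card_ord max_card.
apply: (leq_trans le_k); apply: leq_trans (leq_addl _ _).
rewrite -[X in X <= _]muln1 leq_mul2l; apply/orP; right.
rewrite (bigD1 (a, b)) //=.
by move: aH bH; rewrite !inE => -> ->; rewrite leq_addr.
Qed.

Lemma sum_load : \sum_(u in S) load u <= 2 * #|S|.
Proof.
apply: (@leq_trans (\sum_(u in S) (1 + k *
    \sum_(p : 'I_k * 'I_k | p.1 < p.2) (u \in doubly_heavy p.1 p.2)))).
  by apply: leq_sum => u _; apply: load_le.
rewrite big_split /= sum1_card mul2n -addnn leq_add2l.
rewrite -big_distrr /= exchange_big /=.
have kk : 0 < k ^ 2 by rewrite expn_gt0 k0.
rewrite -(leq_pmul2l kk) mulnA -[k ^ 2 * k](expnSr k 2).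
rewrite big_distrr /=.
apply: (@leq_trans (\sum_(p : 'I_k * 'I_k | p.1 < p.2) #|S|)).
  apply: leq_sum => -[a b] /= ab; apply: leq_trans (card_doubly_heavy ab).
  rewrite leq_mul2l -sum1_card [leqLHS]big_mkcond [X in _ <= X]big_mkcond.
  by apply/orP; right; apply: leq_sum => u _; case: (u \in S).
rewrite sum_nat_const leq_mul2r; apply/orP; right.
by apply: leq_trans (max_card _) _; rewrite card_prod card_ord mulnn.
Qed.

(** Of the k |S| visits at most 2 |S| are to heavy blocks: one per element is tolerated, and the
    doubly heavy elements add at most one on average. Every light block keeps d - 2 neighbours per
    visitor, and blocks are disjoint. *)
Theorem routed_expands :
  (d - 2) * (k - 2) * #|S| <= #|\bigcup_(u in S) routed u|.
Proof.
set N := \bigcup_(u in S) routed u.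
pose slice (w : V) (a : 'I_k) : {set 'I_M} := [set r | ((w, a), r) \in N].
have cardN : #|N| = \sum_a \sum_w #|slice w a|.
  rewrite -sum1_card exchange_big pair_bigA /=.
  rewrite (partition_big (fun x : V * 'I_k * 'I_M => x.1) xpredT) //=.
  apply: eq_bigr => -[w a] _.
  rewrite sum1dep_card -[RHS](card_imset _ (f := fun r => ((w, a), r))).
    2: by move=> r r' [].
  apply: eq_card => -[wa r]; rewrite inE /=.
  apply/andP/imsetP => [[xN /eqP e]|[r' + [-> ->]]]; last by rewrite inE => ->.
  by exists r; rewrite ?inE -?e.
have slice_fiber w a : \bigcup_(l in fiber w a) h l \subset slice w a.
  apply/bigcupsP => l /imsetP[u + ->]; rewrite inE => /andP[uS /eqP e].
  apply/subsetP => r hr; rewrite inE; apply/bigcupP; exists u => //.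
  by rewrite inE /= e eqxx.
have light w a : w \notin heavy a -> (d - 2) * #|visitors w a| <= #|slice w a|.
  rewrite inE -leqNgt -card_fiber => /h_expands /leq_trans; apply.
  exact: subset_leq_card (slice_fiber w a).
apply: (@leq_trans ((d - 2) * \sum_a \sum_(w | w \notin heavy a) #|visitors w a|)).
  rewrite -mulnA leq_mul2l; apply/orP; right.
  have : \sum_(a < k) #|S| <=
      \sum_a \sum_(w | w \notin heavy a) #|visitors w a| + 2 * #|S|.
    suff : \sum_(a < k) #|S| <=
        \sum_a \sum_(w | w \notin heavy a) #|visitors w a| + \sum_(u in S) load u.
      by move=> le; apply: (leq_trans le); rewrite leq_add2l; exact: sum_load.
    have -> : \sum_(u in S) load u = \sum_a #|[set u in S | route u.2 a u.1 \in heavy a]|.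
      under eq_bigr do rewrite /load -sum1dep_card big_mkcond.
      rewrite exchange_big; apply: eq_bigr => a _.
      by rewrite -big_mkcondr -sum1dep_card.
    rewrite -big_split; apply: leq_sum => a _ /=.
    rewrite sum_visitors -cardsUI -[X in X <= _]addn0 leq_add // subset_leq_card //.
    by apply/subsetP => u uS; rewrite !inE uS /= orNb.
  rewrite sum_nat_const card_ord mulnBl; lia.
rewrite cardN big_distrr; apply: leq_sum => a _ /=.
rewrite big_distrr [leqLHS]big_mkcond; apply: leq_sum => w _ /=.
by case: ifP => // /light.
Qed.

End Expansion.
End Routing.

(** * Programs *)

Section Runs.
Local Open Scope nat_scope.

(** A total-correctness triple with a time budget; [T] is only an upper bound, so costs can be
    rounded freely. *)
Definition runs (c : cmd) (s : memory) (T : nat) (Q : memory -> Prop) :=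
  exists t s', [/\ exec c s t s', t <= T & Q s'].

Definition frame (A : seq nat) (s s' : memory) :=
  forall a, a \notin A -> s' a = s a.

Lemma runs_weaken c s T T' (Q Q' : memory -> Prop) :
  runs c s T Q -> T <= T' -> (forall s', Q s' -> Q' s') -> runs c s T' Q'.
Proof.
move=> [t [s' [ex le Qs]]] leT QQ'; exists t, s'; split=> //.
  exact: leq_trans leT.
exact: QQ'.
Qed.

Lemma runs_skip s (Q : memory -> Prop) : Q s -> runs Skip s 1 Q.
Proof. by exists 1, s; split=> //; apply: ExecSkip. Qed.

Lemma runs_store a e s (Q : memory -> Prop) :
  Q (update s (eval s a) (eval s e)) -> runs (Store a e) s 1 Q.
Proof. by move=> Qs; exists 1; eexists; split; [apply: ExecStore| |apply: Qs]. Qed.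

Lemma runs_seq c1 c2 s T1 T2 Q :
  runs c1 s T1 (fun s1 => runs c2 s1 T2 Q) -> runs (Seq c1 c2) s (T1 + T2) Q.
Proof.
move=> [t1 [s1 [e1 l1 [t2 [s2 [e2 l2 Qs]]]]]].
by exists (t1 + t2), s2; split; [apply: ExecSeq e1 e2|apply: leq_add|].
Qed.

Lemma runs_if e c1 c2 s T Q :
  runs (if eval s e != 0 then c1 else c2) s T Q -> runs (If e c1 c2) s T.+1 Q.
Proof.
case: ifP => [e1|/negbFE/eqP e0] [t [s' [ex le Qs]]]; exists t.+1, s'.
  by split=> //; apply: ExecIfTrue.
by split=> //; apply: ExecIfFalse.
Qed.

(** The bound is evaluated once, so the body may change the cells it mentions. The counter is
    decremented before the body, which therefore sees [N - i.+1] and has to preserve it. *)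
Definition For (t : nat) (e : expr) (body : cmd) : cmd :=
  Seq (Store (Const t) e)
    (While (Get (Const t))
      (Seq (Store (Const t) (Pred (Get (Const t)))) body)).

Lemma runs_for t e body s N T (I : nat -> memory -> Prop) :
  eval s e = N -> I 0 (update s t N) ->
  (forall i s', i < N -> I i s' -> s' t = N - i ->
    runs body (update s' t (N - i.+1)) T
      (fun s'' => I i.+1 s'' /\ s'' t = N - i.+1)) ->
  runs (For t e body) s (2 + N * (T + 2)) (fun s' => I N s' /\ s' t = 0).
Proof.
move=> eN I0 step_body.
rewrite -[2 + _]/(1 + (1 + N * (T + 2))).
apply: runs_seq; apply: runs_store; rewrite /= eN.
have loop : forall j i s1, i + j = N -> I i s1 -> s1 t = j ->
    runs (While (Get (Const t)) (Seq (Store (Const t) (Pred (Get (Const t)))) body))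
      s1 (1 + j * (T + 2)) (fun s' => I N s' /\ s' t = 0).
  elim=> [|j IHj] i s1 ij Ii s1t.
    exists 1, s1; split=> //; first exact: ExecWhileFalse.
    by rewrite -ij addn0.
  have Nj : N - i.+1 = j by lia.
  have [||t1 [s2 [ex1 le1 [Is2 s2t]]]] := step_body i s1 _ Ii.
  - by lia.
  - by lia.
  have [||t2 [s3 [ex2 le2 Q3]]] := IHj i.+1 s2 _ Is2; [by lia..|].
  exists ((1 + t1) + t2).+1, s3; split=> //; last by rewrite mulSn; lia.
  apply: ExecWhileTrue ex2; first by rewrite /= s1t.
  apply: ExecSeq ex1.
  have -> : update s1 t (N - i.+1)
      = update s1 (eval s1 (Const t)) (eval s1 (Pred (Get (Const t)))).
    by rewrite /= s1t Nj.
  exact: ExecStore.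
by apply: (loop N 0); rewrite // /update eqxx.
Qed.

Definition succs (c : nat) (e : expr) : expr := iter c Succ e.

Lemma eval_succs s c e : eval s (succs c e) = c + eval s e.
Proof. by elim: c => //= c ->. Qed.

Definition Reg (r : nat) : expr := Get (Const r).

Definition add_scaled (x c : nat) (e : expr) (t : nat) : cmd :=
  For t e (Store (Const x) (succs c (Reg x))).

Lemma runs_add_scaled (x c : nat) e (t : nat) s : x != t ->
  runs (add_scaled x c e t) s (2 + eval s e * 3)
    (fun s' => s' x = s x + eval s e * c /\ frame [:: x; t] s s').
Proof.
move=> xt; set N := eval s e.
apply: runs_weaken (_ : runs _ _ (2 + N * (1 + 2)) _) _ _ => //.
  apply: (@runs_for _ _ _ _ _ _ (fun i s' =>
    s' x = s x + i * c /\ frame [:: x; t] s s')) => //.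
    split; first by rewrite /update (negPf xt) addn0.
    by move=> a; rewrite !inE negb_or /update => /andP[_ /negPf ->].
  move=> i s' iN [s'x fr] s't; apply: runs_store; rewrite eval_succs /=.
  have tx : (t == x) = false by rewrite eq_sym (negPf xt).
  rewrite /update; split; last by rewrite tx eqxx.
  split=> [|a]; first by rewrite eqxx (negPf xt) s'x; lia.
  rewrite !inE negb_or => /andP[ax at_]; rewrite (negPf ax) (negPf at_).
  by apply: fr; rewrite !inE negb_or ax.
by move=> s' [].
Qed.

Definition add_product (x c p q : nat) : cmd :=
  For 12 (Reg p) (add_scaled x c (Reg q) 13).

Lemma runs_add_product (x c p q : nat) s :
  x \notin [:: 12; 13] -> q \notin [:: x; 12; 13] ->
  runs (add_product x c p q) s (2 + s p * (2 + s q * 3 + 2))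
    (fun s' => s' x = s x + s p * (s q * c) /\ frame [:: x; 12; 13] s s').
Proof.
rewrite !inE !negb_or => /andP[x12 x13] /and3P[qx q12 q13].
pose J i (s' : memory) :=
  s' x = s x + i * (s q * c) /\ frame [:: x; 12; 13] s s'.
apply: (@runs_weaken _ _ (2 + s p * (2 + s q * 3 + 2)) _
  (fun s' => J (s p) s' /\ s' 12 = 0)) => //; last by move=> s' [].
apply: runs_for => //.
  split; first by rewrite /update (negPf x12) addn0.
  by move=> a; rewrite !inE !negb_or /update => /and3P[_ /negPf ->].
move=> i s' lt_i [s'x fr] s'12; set s2 := update s' 12 _.
have s2x : s2 x = s' x by rewrite /s2 /update (negPf x12).
have s2q : s2 q = s q.
  by rewrite /s2 /update (negPf q12) fr // !inE !negb_or qx q12.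
have := @runs_add_scaled x c (Reg q) 13 s2 x13; rewrite /= s2q => r.
apply: (runs_weaken r) => // s'' [s''x fr'']; split; last first.
  by rewrite fr'' /s2 /update // !inE eq_sym (negPf x12).
split; first by rewrite s''x s2x s'x; lia.
move=> a; rewrite !inE !negb_or => /and3P[ax a12 a13].
by rewrite fr'' ?inE ?negb_or ?ax // /s2 /update (negPf a12) fr // !inE !negb_or ax a12.
Qed.

Definition subtract (x : nat) (e : expr) (t : nat) : cmd :=
  For t e (Store (Const x) (Pred (Reg x))).

Lemma runs_subtract (x : nat) e (t : nat) s : x != t ->
  runs (subtract x e t) s (2 + eval s e * 3)
    (fun s' => s' x = s x - eval s e /\ frame [:: x; t] s s').
Proof.
move=> xt; set N := eval s e.
apply: runs_weaken (_ : runs _ _ (2 + N * (1 + 2)) _) _ _ => //.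
  apply: (@runs_for _ _ _ _ _ _ (fun i s' =>
    s' x = s x - i /\ frame [:: x; t] s s')) => //.
    split; first by rewrite /update (negPf xt) subn0.
    by move=> a; rewrite !inE negb_or /update => /andP[_ /negPf ->].
  move=> i s' iN [s'x fr] s't; apply: runs_store => /=.
  have tx : (t == x) = false by rewrite eq_sym (negPf xt).
  rewrite /update; split; last by rewrite tx eqxx.
  split=> [|a]; first by rewrite eqxx (negPf xt) s'x; lia.
  rewrite !inE negb_or => /andP[ax at_]; rewrite (negPf ax) (negPf at_).
  by apply: fr; rewrite !inE negb_or ax.
by move=> s' [].
Qed.

(* Memory layout: cells 0 and 1 hold the two sizes; 2: the modulus m; 3: m Q;
   4: address of the start of the current row, after the padding; 5, 6: the
   current vertex; 7, 8: loop counters; 9, 10: the walker; 11 to 15: scratch.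
   The bits start at 16, since cells 2 to 15 are those of the padding vertices
   in the first row. *)
Definition inc_mod (x : nat) : cmd :=
  Seq (Store (Const x) (Succ (Reg x)))
  (Seq (Store (Const 14) (Reg 2))
  (Seq (subtract 14 (Reg x) 15)
       (If (Reg 14) Skip (Store (Const x) (Const 0))))).

Lemma runs_inc_mod x s : x \in [:: 9; 10] -> s x < s 2 ->
  runs (inc_mod x) s (10 * s 2)
    (fun s' => s' x = (s x).+1 %% s 2 /\ frame [:: x; 14; 15] s s').
Proof.
move=> x_reg lt_x.
have [x14 x15 x2] : [/\ x != 14, x != 15 & x != 2].
  by move: x_reg; rewrite !inE => /orP[] /eqP ->.
set s1 := update s x (s x).+1; set s2 := update s1 14 (s 2).
have s2x : s2 x = (s x).+1 by rewrite /s2 /s1 /update (negPf x14) eqxx.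
apply: runs_weaken (_ : runs _ _ (1 + (1 + ((2 + (s x).+1 * 3) + 2))) _) _
  (fun s' h => h).
  apply: runs_seq; apply: runs_store => /=; rewrite -/s1.
  apply: runs_seq; apply: runs_store => /=.
  have -> : s1 2 = s 2 by rewrite /s1 /update eq_sym (negPf x2).
  rewrite -/s2; apply: runs_seq.
  have := @runs_subtract 14 (Reg x) 15 s2 isT; rewrite /= s2x => runs_sub.
  apply: (runs_weaken runs_sub) => // s3 [s3_14 fr3].
  have s3x : s3 x = (s x).+1 by rewrite fr3 // !inE (negPf x14) (negPf x15).
  have s3a a : a \notin [:: x; 14; 15] -> s3 a = s a.
    rewrite !inE !negb_or => /and3P[ax a14 a15].
    by rewrite fr3 ?inE ?negb_or ?a14 // /s2 /s1 /update (negPf ax) (negPf a14).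
  (* Subtraction is truncated and the incremented value is at most the modulus, so cell 14 is 0
     exactly when the modulus is reached. *)
  apply: runs_if; rewrite /= s3_14 {1}/s2 /update /=.
  case: ifP => nz.
    apply: runs_skip; split=> //; rewrite s3x modn_small //; lia.
  apply: runs_store => /=; rewrite /update eqxx; split.
    have -> : (s x).+1 = s 2 by lia.
    by rewrite modnn.
  by move=> a an; rewrite ifF ?s3a //; move: an; rewrite !inE negb_or => /andP[/negPf].
lia.
Qed.

Definition add_mod (x y : nat) : cmd := For 13 (Reg y) (inc_mod x).

Lemma runs_add_mod x y s : x \in [:: 9; 10] -> s x < s 2 -> s y < s 2 ->
  runs (add_mod x y) s (14 * s 2 ^ 2)
    (fun s' => s' x = (s x + s y) %% s 2 /\ frame [:: x; 13; 14; 15] s s').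
Proof.
move=> x_reg lt_x lt_y.
have [x13 x14 [x15 x2]] : [/\ x != 13, x != 14 & x != 15 /\ x != 2].
  by move: x_reg; rewrite !inE => /orP[] /eqP ->.
pose I i s' := s' x = (s x + i) %% s 2 /\ frame [:: x; 13; 14; 15] s s'.
apply: (@runs_weaken _ _ (2 + s y * (10 * s 2 + 2)) _
    (fun s' => I (s y) s' /\ s' 13 = 0)); last first.
- by move=> s' [].
- by rewrite -mulnn; nia.
apply: runs_for => //.
  split; first by rewrite /update (negPf x13) addn0 modn_small.
  by move=> a; rewrite !inE !negb_or /update => /and4P[_ /negPf ->].
move=> i s' lt_i [s'x fr] s'13; set s1 := update s' 13 _.
have s1x : s1 x = (s x + i) %% s 2 by rewrite /s1 /update (negPf x13).
have s12 : s1 2 = s 2.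
  by rewrite /s1 /update /= fr // !inE eq_sym (negPf x2).
have := @runs_inc_mod x s1 x_reg; rewrite s1x s12 ltn_mod.
move=> /(_ (leq_ltn_trans (leq0n _) lt_x)) runs_inc.
apply: (runs_weaken runs_inc) => // s2 [s2x fr2]; split; last first.
  by rewrite fr2 /s1 /update // !inE eq_sym (negPf x13).
split; first by rewrite s2x -addn1 modnDml addn1 addnS.
move=> a; rewrite !inE !negb_or => /and4P[ax a13 a14 a15].
rewrite fr2 ?inE ?negb_or ?ax ?a14 // /s1 /update (negPf a13) fr //.
by rewrite !inE !negb_or ax a13 a14.
Qed.

Definition step_cmd (o : step) : cmd :=
  match o with
  | None => Skip
  | Some (false, false) => inc_mod 9
  | Some (false, true) => inc_mod 10
  | Some (true, false) => add_mod 9 10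
  | Some (true, true) => add_mod 10 9
  end.

Lemma runs_step m (v : 'I_m.+2 * 'I_m.+2) o s :
  s 2 = m.+2 -> s 9 = v.1 -> s 10 = v.2 ->
  runs (step_cmd o) s (14 * m.+2 ^ 2)
    (fun s' => [/\ s' 9 = (act o v).1, s' 10 = (act o v).2
                 & frame [:: 9; 10; 13; 14; 15] s s']).
Proof.
move=> s2 s9 s10.
have val_succ i : (i + 1 %% m.+2) %% m.+2 = i.+1 %% m.+2.
  by rewrite modnDmr addn1.
have le_T : 10 * m.+2 <= 14 * m.+2 ^ 2 by rewrite -mulnn; nia.
case: o => [[[] []]|] /=.
- have := @runs_add_mod 10 9 s isT; rewrite s2 s9 s10 !ltn_ord => /(_ isT isT) r.
  apply: (runs_weaken r) => // s' [h fr]; split=> //; first by rewrite fr.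
  move=> a; rewrite !inE !negb_or => /and5P[? ? ? ? ?].
  by rewrite fr // !inE !negb_or; apply/and4P.
- have := @runs_add_mod 9 10 s isT; rewrite s2 s9 s10 !ltn_ord => /(_ isT isT) r.
  apply: (runs_weaken r) => // s' [h fr]; split=> //; first by rewrite fr.
  move=> a; rewrite !inE !negb_or => /and5P[? ? ? ? ?].
  by rewrite fr // !inE !negb_or; apply/and4P.
- have := @runs_inc_mod 10 s isT; rewrite s2 s10 ltn_ord => /(_ isT) r.
  apply: (runs_weaken r) => // s' [h fr]; split; rewrite ?val_succ //.
    by rewrite fr.
  move=> a; rewrite !inE !negb_or => /and5P[? ? ? ? ?].
  by rewrite fr // !inE !negb_or; apply/and3P.
- have := @runs_inc_mod 9 s isT; rewrite s2 s9 ltn_ord => /(_ isT) r.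
  apply: (runs_weaken r) => // s' [h fr]; split; rewrite ?val_succ //.
    by rewrite fr.
  move=> a; rewrite !inE !negb_or => /and5P[? ? ? ? ?].
  by rewrite fr // !inE !negb_or; apply/and3P.
apply: (runs_weaken (runs_skip (Q := fun s' => s' = s) _)) => //.
by move=> s' ->; split.
Qed.

End Runs.

(** * Graphs described by walker instructions, and the program that outputs them *)

Section PlanGraph.
Local Open Scope nat_scope.

(* One instruction of a walker: either take a step, or connect the row to the
   right vertex with offset [c] in the block of the current position. *)
Definition instr := (step + nat)%type.

Fixpoint emits m (I : seq instr) (v : 'I_m.+2 * 'I_m.+2) :
    seq (('I_m.+2 * 'I_m.+2) * nat) :=
  match I with
  | [::] => [::]
  | inl o :: I' => emits I' (act o v)
  | inr c :: I' => (v, c) :: emits I' v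
  end.

Definition vindex m (v : 'I_m.+2 * 'I_m.+2) : nat := v.1 * m.+2 + v.2.

Definition vertex m (i : nat) : 'I_m.+2 * 'I_m.+2 :=
  (inord (i %/ m.+2), inord (i %% m.+2)).

Lemma vindex_lt m (v : 'I_m.+2 * 'I_m.+2) : vindex v < m.+2 ^ 2.
Proof.
case: v => x y; rewrite /vindex /= -mulnn.
by have := ltn_ord x; have := ltn_ord y; nia.
Qed.

Lemma vindexK m : cancel (@vindex m) (@vertex m).
Proof.
case=> x y; rewrite /vertex /vindex /= divnMDl // divn_small // addn0.
by rewrite modnMDl modn_small // !inord_val.
Qed.

Lemma vertexK m i : i < m.+2 ^ 2 -> vindex (vertex m i) = i.
Proof.
move=> lt_i; rewrite /vindex /= !inordK ?ltn_mod // -?divn_eq //.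
by rewrite ltn_divLR // mulnn.
Qed.

Variables (P : seq (seq instr)) (Q : nat).

(** A left vertex is numbered with its label as the lowest digit, so the labels form the innermost
    loop, which the program unrolls. *)
Definition row_of m (u : nat) : seq nat :=
  [seq 14 + vindex x.1 * Q + x.2 |
    x <- emits (nth [::] P (u %% size P)) (vertex m (u %/ size P))].

(* The 14 padding vertices keep the first cells of the output free for the
   registers of the program. *)
Definition plan_graph (m : nat) : bigraph :=
  @BiGraph (m.+2 ^ 2 * size P) (14 + m.+2 ^ 2 * Q)
    (fun u v => (v : nat) \in row_of m u).

Definition emit_cmd (c : nat) : cmd :=
  Seq (Store (Const 11) (Reg 4))
  (Seq (add_product 11 1 9 3)
  (Seq (add_scaled 11 Q (Reg 10) 13)
       (Store (succs c (Reg 11)) (Const 1)))).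

(** The walker and the scratch cells are exempt, so that the property composes along a list of
    instructions. *)
Definition written (s s' : memory) (A : seq nat) :=
  forall a, a \notin [:: 9; 10; 11; 12; 13; 14; 15] ->
    s' a = if a \in A then 1 else s a.

Lemma runs_emit m (v : 'I_m.+2 * 'I_m.+2) (c : nat) (s : memory) (B : nat) :
  s 9 = v.1 -> s 10 = v.2 -> s 3 = m.+2 * Q -> 16 <= s 4 ->
  m.+2 <= B -> s 3 <= B ->
  runs (emit_cmd c) s (16 * B ^ 2)
    (fun s' => [/\ s' 9 = v.1, s' 10 = v.2
                 & written s s' [:: s 4 + vindex v * Q + c]]).
Proof.
move=> s9 s10 s3 s4 mO s3O; set s1 := update s 11 (s 4).
apply: (@runs_weaken _ _ (1 + ((2 + v.1 * ((2 + s 3 * 3) + 2)) + ((2 + v.2 * 3) + 1))) _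
  (fun s' => [/\ s' 9 = v.1, s' 10 = v.2
                 & written s s' [:: s 4 + vindex v * Q + c]])) => //; last first.
  rewrite -mulnn; have := ltn_ord v.1; have := ltn_ord v.2 => v2 v1.
  have : v.1 * (2 + s 3 * 3 + 2) <= B * (4 + B * 3) by apply: leq_mul; lia.
  nia.
apply: runs_seq; apply: runs_store => /=; rewrite -/s1; apply: runs_seq.
have := @runs_add_product 11 1 9 3 s1 isT isT; rewrite muln1.
have -> : s1 9 = v.1 by [].
have -> : s1 11 = s 4 by [].
have -> : s1 3 = s 3 by [].
move=> r; apply: (runs_weaken r) => // s2 [s2_11 fr1]; apply: runs_seq.
have fr2 : frame [:: 11; 12; 13] s s2.
  move=> a an; rewrite fr1 // /s1 /update; move: an.
  by rewrite !inE !negb_or => /and3P[/negPf ->].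
have := @runs_add_scaled 11 Q (Reg 10) 13 s2 isT.
rewrite /= (fr2 10) // s10 => {}r; apply: (runs_weaken r) => // s3' [s3_11 fr3].
apply: runs_store; rewrite eval_succs /= s3_11 s2_11.
have -> : c + (s 4 + v.1 * s 3 + v.2 * Q) = s 4 + vindex v * Q + c.
  by rewrite s3 /vindex; ring.
set adr := _ + c; have adr16 : 16 <= adr by rewrite /adr; lia.
have ad i : i < 16 -> (i == adr) = false by move=> lt; apply/eqP; lia.
split; first by rewrite /update ad // fr3 // fr2.
  by rewrite /update ad // fr3 // fr2.
move=> a an; rewrite inE /update; case: eqP => // _.
move: an; rewrite !inE !negb_or => /and5P[_ _ a11 a12 /and3P[a13 _ _]].
by rewrite fr3 ?inE ?negb_or ?a11 // fr2 // !inE !negb_or a11 a12.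
Qed.

Definition instr_cmd (i : instr) : cmd :=
  match i with inl o => step_cmd o | inr c => emit_cmd c end.

Definition block (cs : seq cmd) : cmd := foldr Seq Skip cs.

Lemma runs_instrs m I (v : 'I_m.+2 * 'I_m.+2) (s : memory) B :
  s 2 = m.+2 -> s 9 = v.1 -> s 10 = v.2 -> s 3 = m.+2 * Q -> 16 <= s 4 ->
  m.+2 <= B -> s 3 <= B ->
  runs (block (map instr_cmd I)) s (size I * (16 * B ^ 2) + 1)
    (fun s' => written s s' [seq s 4 + vindex x.1 * Q + x.2 | x <- emits I v]).
Proof.
elim: I v s => [|i I IHI] v s s2 s9 s10 s3 s4 mO s3O.
  by apply: runs_skip => a an; rewrite in_nil.
rewrite [size _ * _]mulSn -addnA.
apply: (@runs_seq (instr_cmd i) (block (map instr_cmd I))); case: i => [o|c].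
  apply: (runs_weaken (runs_step o s2 s9 s10)).
    by apply: leq_mul => //; rewrite leq_exp2r.
  move=> s' [s'9 s'10 fr]; apply: (runs_weaken (IHI (act o v) s' _ _ _ _ _ _ _)) => //;
    rewrite ?fr // => s'' wr a an /=.
  rewrite (wr a an) fr //; move: an.
  by rewrite !inE !negb_or => /and5P[-> -> _ _ /and3P[-> -> ->]].
apply: (runs_weaken (runs_emit c s9 s10 s3 s4 mO s3O)) => // s' [s'9 s'10 wr].
have keep r : r \in [:: 2; 3; 4] -> s' r = s r.
  move=> rr; have lt_r : r < 9 by move: rr; rewrite !inE => /or3P[] /eqP ->.
  rewrite wr; last by rewrite !inE; lia.
  by rewrite inE ifF //; apply/eqP; lia.
apply: (runs_weaken (IHI v s' _ _ _ _ _ _ _)) => //; rewrite ?keep // => s'' wr' a an /=.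
by rewrite (wr' a an) (wr a an) !inE; case: (_ \in map _ _); rewrite ?orbT ?orbF.
Qed.

Variable m : nat.
Local Notation G := (plan_graph m).

Fixpoint table (u : nat) : seq nat :=
  if u is u'.+1 then [seq 2 + u' * nR G + v | v <- row_of m u'] ++ table u'
  else [::].

(** The invariant after [u] rows. The loop counters 7 and 8 are left out, so it survives the updates
    made by [For]; the inner commands report separately which counters they keep. *)
Record progress (u x y : nat) (s : memory) : Prop := Progress {
  cell0 : s 0 = nL G;
  cell1 : s 1 = nR G;
  cell2 : s 2 = m.+2;
  cell3 : s 3 = m.+2 * Q;
  cell4 : s 4 = 16 + u * nR G;
  cell5 : s 5 = x;
  cell6 : s 6 = y;
  bits : forall a, 16 <= a -> s a = (a \in table u) }.

Definition row_cmd (I : seq instr) : cmd :=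
  Seq (Store (Const 9) (Reg 5))
  (Seq (Store (Const 10) (Reg 6))
  (Seq (block (map instr_cmd I)) (add_scaled 4 1 (Reg 1) 12))).

Variable B : nat.
Hypothesis m_le : m.+2 <= B.
Hypothesis mQ_le : m.+2 * Q <= B.
Hypothesis nR_le : nR G <= B.

Lemma B_gt1 : 1 < B.
Proof. exact: leq_trans m_le. Qed.

Lemma runs_row I u (v : 'I_m.+2 * 'I_m.+2) (s : memory) :
  progress u v.1 v.2 s -> vertex m (u %/ size P) = v ->
  nth [::] P (u %% size P) = I ->
  runs (row_cmd I) s ((16 * size I + 8) * B ^ 2)
    (fun s' => [/\ progress u.+1 v.1 v.2 s', s' 7 = s 7 & s' 8 = s 8]).
Proof.
move=> pr uv uI; have O1 := B_gt1.
apply: (@runs_weaken _ _ (1 + (1 + ((size I * (16 * B ^ 2) + 1) + (2 + nR G * 3)))) _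
    (fun s' => [/\ progress u.+1 v.1 v.2 s', s' 7 = s 7 & s' 8 = s 8])) => //.
  apply: runs_seq; apply: runs_store => /=; rewrite (cell5 pr).
  apply: runs_seq; apply: runs_store => /=.
  have -> : update s 9 v.1 6 = v.2 by rewrite -(cell6 pr).
  set s1 := update (update s 9 v.1) 10 v.2; apply: runs_seq.
  have s1E a : a \notin [:: 9; 10] -> s1 a = s a.
    by rewrite !inE negb_or /s1 /update => /andP[/negPf -> /negPf ->].
  have s14 : s1 4 = 16 + u * nR G by rewrite s1E // (cell4 pr).
  have := @runs_instrs m I v s1 B; rewrite (s1E 2) // (s1E 3) //.
  rewrite s14 (cell2 pr) (cell3 pr).
  move=> /(_ erefl erefl erefl erefl (leq_addr _ _) m_le mQ_le) r.
  apply: (runs_weaken r) => // s2 wr.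
  set A := map _ _ in wr.
  have A_ge a : a < 16 -> a \in A = false.
    move=> lt_a; apply/negbTE/mapP => -[x _ eq_a]; lia.
  have s2E a : a < 9 -> s2 a = s a.
    move=> lt_a; rewrite wr; last by rewrite !inE; lia.
    rewrite A_ge ?s1E //; last by apply: leq_trans lt_a _.
    by rewrite !inE; lia.
  have := @runs_add_scaled 4 1 (Reg 1) 12 s2 isT; rewrite /= !s2E // (cell1 pr).
  rewrite (cell4 pr) => {}r; apply: (runs_weaken r) => // s3 [s3_4 fr].
  have s3E a : a < 9 -> a != 4 -> s3 a = s a.
    move=> lt_a a4; rewrite fr ?s2E // !inE; lia.
  split; [split|exact: s3E|exact: s3E].
  - by rewrite s3E // (cell0 pr).
  - by rewrite s3E // (cell1 pr).
  - by rewrite s3E // (cell2 pr).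
  - by rewrite s3E // (cell3 pr).
  - by rewrite s3_4; lia.
  - by rewrite s3E // (cell5 pr).
  - by rewrite s3E // (cell6 pr).
  move=> a a16; rewrite fr; last by rewrite !inE; lia.
  rewrite wr; last by rewrite !inE; lia.
  rewrite s1E; last by rewrite !inE; lia.
  rewrite (bits pr a16) /= mem_cat.
  have -> : a \in [seq 2 + u * nR G + v0 | v0 <- row_of m u] = (a \in A).
    rewrite /row_of -map_comp uv uI /A; congr (a \in _); apply: eq_map => x /=.
    by lia.
  by case: (a \in A).
rewrite -mulnn; nia.
Qed.

Definition rows_cost (Ps : seq (seq instr)) : nat :=
  \sum_(I <- Ps) (16 * size I + 8).

(** Induction along the unrolled code: the prefix [P1] already executed tells which row comes
    next. *)
Lemma runs_rows P1 P2 i (v : 'I_m.+2 * 'I_m.+2) (s : memory) :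
  P = P1 ++ P2 -> vertex m i = v ->
  progress (i * size P + size P1) v.1 v.2 s ->
  runs (block (map row_cmd P2)) s (rows_cost P2 * B ^ 2 + 1)
    (fun s' => [/\ progress (i.+1 * size P) v.1 v.2 s', s' 7 = s 7 & s' 8 = s 8]).
Proof.
elim: P2 P1 s => [|I P2 IHP] P1 s PE iv pr.
  rewrite /rows_cost big_nil mul0n add0n; apply: runs_skip; split=> //.
  by rewrite mulSn addnC; move: pr; rewrite [in size P1](_ : P1 = P) // PE cats0.
rewrite /rows_cost big_cons -/(rows_cost _) mulnDl -addnA.
apply: (@runs_seq (row_cmd I) (block (map row_cmd P2))).
have lt_P : size P1 < size P by rewrite PE size_cat /=; lia.
have r := runs_row pr (I := I).
rewrite divnMDl ?(leq_ltn_trans _ lt_P) // divn_small // addn0 in r.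
rewrite modnMDl modn_small // PE nth_cat ltnn subnn in r.
apply: (runs_weaken (r iv erefl)) => // s' [pr' s'7 s'8].
have := IHP (rcons P1 I) s'; rewrite size_rcons addnS -s'7 -s'8; apply=> //.
  by rewrite PE cat_rcons.
by rewrite PE.
Qed.

Lemma progress_update u x y s r w : r \in [:: 7; 8] ->
  progress u x y s -> progress u x y (update s r w).
Proof.
move=> r_cnt [s0 s1 s2 s3 s4 s5 s6 b].
have upd a : a \notin [:: 7; 8] -> update s r w a = s a.
  by move=> an; rewrite /update ifF //; apply/eqP => ar; rewrite ar r_cnt in an.
by split; rewrite ?upd // => a a16; rewrite upd ?b // !inE; lia.
Qed.

Definition vertex_cmd : cmd :=
  Seq (block (map row_cmd P)) (Store (Const 6) (Succ (Reg 6))).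

Lemma runs_vertex x y (s : memory) : x < m.+2 -> y < m.+2 ->
  progress ((x * m.+2 + y) * size P) x y s ->
  runs vertex_cmd s (rows_cost P * B ^ 2 + 2)
    (fun s' => [/\ progress ((x * m.+2 + y.+1) * size P) x y.+1 s',
                    s' 7 = s 7 & s' 8 = s 8]).
Proof.
move=> lt_x lt_y pr; set v := vertex m (x * m.+2 + y).
have v1 : v.1 = x :> nat by rewrite /= divnMDl // divn_small // addn0 inordK.
have v2 : v.2 = y :> nat by rewrite /= modnMDl modn_small // inordK.
rewrite -[2]/(1 + 1) addnA; apply: runs_seq.
have := @runs_rows [::] P (x * m.+2 + y) v s erefl erefl.
rewrite addn0 v1 v2 => /(_ pr) r; apply: (runs_weaken r) => // s' [pr' s'7 s'8].
apply: runs_store => /=; rewrite (cell6 pr') addnS; split=> //.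
case: pr' => c0 c1 c2 c3 c4 c5 c6 b; split=> // a a16.
by rewrite /update ifF ?b //; apply/eqP; lia.
Qed.

Definition column_cmd : cmd :=
  Seq (Store (Const 6) (Const 0))
  (Seq (For 8 (Reg 2) vertex_cmd) (Store (Const 5) (Succ (Reg 5)))).

Lemma runs_column x y (s : memory) : x < m.+2 ->
  progress (x * m.+2 * size P) x y s ->
  runs column_cmd s ((rows_cost P + 6) * B ^ 3)
    (fun s' => progress (x.+1 * m.+2 * size P) x.+1 m.+2 s' /\ s' 7 = s 7).
Proof.
move=> lt_x pr; have O1 := B_gt1.
pose J i (s' : memory) :=
  progress ((x * m.+2 + i) * size P) x i s' /\ s' 7 = s 7.
apply: (@runs_weaken _ _ (1 + ((2 + m.+2 * (rows_cost P * B ^ 2 + 2 + 2)) + 1)) _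
  (fun s' => progress (x.+1 * m.+2 * size P) x.+1 m.+2 s' /\ s' 7 = s 7)) => //.
  apply: runs_seq; apply: runs_store => /=; set s1 := update s 6 0.
  have pr1 : progress (x * m.+2 * size P) x 0 s1.
    case: pr => c0 c1 c2 c3 c4 c5 c6 b; split=> // a a16.
    by rewrite /s1 /update ifF ?b //; apply/eqP; lia.
  apply: runs_seq.
  apply: (@runs_weaken _ _ (2 + m.+2 * (rows_cost P * B ^ 2 + 2 + 2)) _
    (fun s' => J m.+2 s' /\ s' 8 = 0)) => //.
    apply: runs_for => /=; first by rewrite (cell2 pr1).
      by split=> //; rewrite addn0; apply: progress_update.
    move=> i s' lt_i [pr' s'7] s'8; set s2 := update s' 8 _.
    have pr2 : progress ((x * m.+2 + i) * size P) x i s2 by apply: progress_update.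
    apply: (runs_weaken (runs_vertex lt_x lt_i pr2)) => // s'' [pr'' s''7 s''8].
    by split; [split=> //; rewrite s''7 -s'7 | rewrite s''8].
  move=> s' [[pr' s'7] _]; apply: runs_store => /=; rewrite (cell5 pr').
  split=> //; rewrite mulSn addnC; case: pr' => c0 c1 c2 c3 c4 c5 c6 b.
  by split=> // a a16; rewrite /update ifF ?b //; apply/eqP; lia.
have : m.+2 * (rows_cost P * B ^ 2 + 2 + 2) <= B * (rows_cost P * B ^ 2 + 4).
  by apply: leq_mul => //; lia.
by rewrite !expnS expn0 muln1; nia.
Qed.

(** The index is read from cell 0 before that cell is reused for a size; cell 1 starts at 14 to
    count the padding vertices. *)
Definition init_cmd (m0 : nat) : cmd := block
  [:: Store (Const 2) (succs m0.+2 (Reg 0));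
      add_scaled 3 Q (Reg 2) 12;
      Store (Const 1) (Const 14);
      add_product 1 1 2 3;
      Store (Const 0) (Const 0);
      add_product 0 (size P) 2 2;
      Store (Const 4) (Const 16)].

Lemma runs_init m0 n : m = m0 + n ->
  runs (init_cmd m0) (input n) (30 * B ^ 2) (progress 0 0 0).
Proof.
move=> mE; have O1 := B_gt1.
apply: (@runs_weaken _ _ (1 + ((2 + m.+2 * 3) + (1 +
  ((2 + m.+2 * (2 + m.+2 * Q * 3 + 2)) + (1 +
  ((2 + m.+2 * (2 + m.+2 * 3 + 2)) + (1 + 1))))))) _ (progress 0 0 0)) => //.
  apply: runs_seq; apply: runs_store; rewrite eval_succs /=.
  set s1 := update _ 2 _; have s12 : s1 2 = m.+2 by rewrite mE.
  apply: runs_seq; have := @runs_add_scaled 3 Q (Reg 2) 12 s1 isT.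
  rewrite /= s12 => r.
  apply: (runs_weaken r) => // s2 [s2_3 fr2].
  apply: runs_seq; apply: runs_store => /=; set s3 := update s2 1 14.
  have s32 : s3 2 = m.+2 by rewrite /s3 /update /= fr2.
  have s33 : s3 3 = m.+2 * Q by rewrite /s3 /update /= s2_3.
  apply: runs_seq; have := @runs_add_product 1 1 2 3 s3 isT isT.
  rewrite s32 s33 => {}r; apply: (runs_weaken r) => // s4 [s4_1 fr4].
  apply: runs_seq; apply: runs_store => /=; set s5 := update s4 0 0.
  have s52 : s5 2 = m.+2 by rewrite /s5 /update /= fr4.
  apply: runs_seq; have := @runs_add_product 0 (size P) 2 2 s5 isT isT.
  rewrite s52 => {}r; apply: (runs_weaken r) => // s6 [s6_0 fr6].
  apply: runs_seq; apply: runs_store => /=; apply: runs_skip.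
  have keep a : a \notin [:: 0; 1; 2; 3; 4; 12; 13] -> update s6 4 16 a = 0.
    rewrite !inE !negb_or => /and5P[a0 a1 a2 a3 /and3P[a4 a12 a13]].
    rewrite /update (negPf a4) fr6 ?inE ?negb_or ?a0 ?a12 //.
    rewrite /s5 /update (negPf a0) fr4 ?inE ?negb_or ?a1 ?a12 //.
    rewrite /s3 /update (negPf a1) fr2 ?inE ?negb_or ?a3 ?a12 //.
    by rewrite /s1 /input /update (negPf a2) (negPf a0).
  split.
  - by rewrite /update /= s6_0 /s5 /update /= -mulnn mulnA.
  - rewrite /update /= fr6 // /s5 /update /= s4_1 /s3 /update /= muln1 -mulnn.
    by rewrite mulnA.
  - by rewrite /update /= fr6.
  - by rewrite /update /= fr6 // /s5 /update /= fr4.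
  - by [].
  - exact: keep.
  - exact: keep.
  - by move=> a a16; rewrite keep // !inE; lia.
have : m.+2 * (2 + m.+2 * Q * 3 + 2) <= B * (4 + B * 3) by apply: leq_mul => //; lia.
have : m.+2 * (2 + m.+2 * 3 + 2) <= B * (4 + B * 3) by apply: leq_mul => //; lia.
rewrite -mulnn; nia.
Qed.

Definition plan_cmd (m0 : nat) : cmd :=
  Seq (init_cmd m0)
  (Seq (For 7 (Reg 2) column_cmd)
       (block [seq Store (Const r) (Const 0) | r <- iota 2 14])).

Lemma runs_clear rs (s : memory) :
  runs (block [seq Store (Const r) (Const 0) | r <- rs]) s (size rs + 1)
    (fun s' => forall a, s' a = if a \in rs then 0 else s a).
Proof.
elim: rs s => [|r rs IHrs] s; first exact: runs_skip.
apply: (@runs_seq _ _ _ 1); apply: runs_store => /=.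
apply: (runs_weaken (IHrs _)) => // s' s'E a.
rewrite s'E inE /update; case: (_ \in rs); rewrite ?orbT //.
by rewrite orbF; case: eqP.
Qed.

Lemma row_of_ge u v : v \in row_of m u -> 14 <= v.
Proof. by move=> /mapP[x _ ->]; rewrite -addnA leq_addr. Qed.

Lemma emits_offset (I : seq instr) (v : 'I_m.+2 * 'I_m.+2) x :
  x \in emits I v -> inr x.2 \in I.
Proof.
elim: I v => [|[o|c] I IHI] v //=; first by move=> /IHI; rewrite inE => ->.
by rewrite !inE => /predU1P[-> | /IHI ->]; rewrite ?eqxx ?orbT.
Qed.

Hypothesis offset_lt : forall I c, I \in P -> inr c \in I -> c < Q.

Lemma row_of_lt u v : v \in row_of m u -> v < nR G.
Proof.
move=> /mapP[[w c] /emits_offset /= cI ->] /=.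
have lt_c : c < Q.
  case: (ltnP (u %% size P) (size P)) => lt_u.
    by apply: offset_lt cI; apply: mem_nth.
  by rewrite nth_default in cI.
rewrite -addnA ltn_add2l; apply: (@leq_trans ((vindex w).+1 * Q)).
  by rewrite mulSn addnC ltn_add2r.
by rewrite leq_mul2r vindex_lt orbT.
Qed.

(** Row-major addresses do not collide, because the entries of every row stay below [nR G]. *)
Lemma mem_table u v n : v < nR G ->
  (2 + (u * nR G + v) \in table n) = (u < n) && (v \in row_of m u).
Proof.
move=> lt_v; elim: n => [|n IHn]; first by rewrite in_nil.
rewrite [table _]/= mem_cat IHn ltnS [u <= n]leq_eqVlt.
case: (eqVneq u n) => [->|un] /=.
  rewrite ltnn orbF addnA mem_map //; exact: addnI.
rewrite orb_idl // => /mapP[v' /row_of_lt lt_v'].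
rewrite -addnA => /addnI eq_uv; case/eqP: un.
have := congr1 (fun i => i %/ nR G) eq_uv.
have nR0 : 0 < nR G by [].
by rewrite /= !divnMDl // !divn_small // !addn0.
Qed.

Lemma runs_plan m0 n : m = m0 + n ->
  runs (plan_cmd m0) (input n) ((rows_cost P + 60) * B ^ 4)
    (fun s => encodes s G).
Proof.
move=> mE; have O1 := B_gt1.
pose J i (s' : memory) := exists y, progress (i * m.+2 * size P) i y s'.
apply: (@runs_weaken _ _ (30 * B ^ 2 +
  ((2 + m.+2 * ((rows_cost P + 6) * B ^ 3 + 2)) + 15)) _
  (fun s => encodes s G)) => //.
  apply: runs_seq; apply: (runs_weaken (runs_init mE)) => // s1 pr1.
  apply: runs_seq.
  apply: (@runs_weaken _ _ (2 + m.+2 * ((rows_cost P + 6) * B ^ 3 + 2)) _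
    (fun s' => J m.+2 s' /\ s' 7 = 0)) => //.
    apply: runs_for => /=; first by rewrite (cell2 pr1).
      by exists 0; apply: progress_update.
    move=> i s' lt_i [y pr'] s'7; set s2 := update s' 7 _.
    have pr2 : progress (i * m.+2 * size P) i y s2 by apply: progress_update.
    apply: (runs_weaken (runs_column lt_i pr2)) => // s'' [pr'' s''7].
    by split; [exists m.+2 | rewrite s''7].
  move=> s' [[y pr'] _].
  apply: (runs_weaken (runs_clear _ _)) => // s'' s''E; split.
  - by rewrite s''E /= (cell0 pr').
  - by rewrite s''E /= (cell1 pr').
  move=> u v; rewrite s''E mem_iota -[2 + 14]/16 leq_addr /=.
  (* Addresses below 16 were used as registers and have been cleared; a neighbour is at least 14, so
     no bit equal to 1 belongs there. *)
  case: ltnP => [lt_a|a16].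
    case: (boolP (_ \in _)) => // /row_of_ge v14.
    move: lt_a; rewrite ltnNge => /negP[].
    by rewrite -[16]/(2 + 14) leq_add2l (leq_trans v14) // leq_addl.
  rewrite (bits pr') // (mem_table u) // mulnn.
  by have := ltn_ord u; rewrite /= => ->.
have : m.+2 * ((rows_cost P + 6) * B ^ 3 + 2) <= B * ((rows_cost P + 6) * B ^ 3 + 2).
  by apply: leq_mul.
rewrite !expnS expn0 muln1; nia.
Qed.

End PlanGraph.

(** * The explicit family *)

Section ExpanderPlan.
Local Open Scope nat_scope.

(** The order of the graph bounds every quantity the program counts to. A row costs order squared,
    and each of the two coordinate loops adds one factor. *)
Theorem plan_poly_time (P : seq (seq instr)) Q m0 : 0 < size P ->
  (forall (I : seq instr) (c : nat), I \in P -> inr c \in I -> c < Q) ->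
  poly_time_constructible (fun n => plan_graph P Q (m0 + n)).
Proof.
move=> P0 offs; exists (plan_cmd P Q m0), (rows_cost P + 60), 4 => n.
set G := plan_graph _ _ _; set m := m0 + n.
have nL_ge : m.+2 <= nL G.
  by rewrite /G /= -mulnn -mulnA leq_pmulr // muln_gt0.
have nR_le : nR G <= Defs.order G by apply: leq_addl.
have nL_le : m.+2 <= Defs.order G by apply: leq_trans nL_ge (leq_addr _ _).
have mQ_le : m.+2 * Q <= Defs.order G.
  apply: leq_trans nR_le; rewrite /G /=; apply: leq_trans (leq_addl _ _).
  by rewrite leq_mul2r -mulnn leq_pmulr ?orbT.
have [t [s [ex le enc]]] := runs_plan nL_le mQ_le nR_le offs (erefl m).
exists t, s; split=> //; apply: leq_trans le _.
by rewrite leq_mul2l leqnSn orbT.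
Qed.

Variables (k p d M : nat).
Local Notation D := (5 ^ (p * k.-1)).
Variable h : 'I_D -> {set 'I_M}.

Definition word (l : 'I_D) : seq step := nth [::] (words (p * k.-1)) l.

Definition route m (l : 'I_D) (a : 'I_k) : 'I_m.+2 * 'I_m.+2 -> 'I_m.+2 * 'I_m.+2 :=
  actw (take (p * a) (word l)).

(** Neighbours are emitted before walking, so k observations use k - 1 segments: at [a = k.-1] the
    word is exhausted and no step is taken. *)
Definition stage (l : 'I_D) (a : nat) : seq instr :=
  [seq inr (a * M + r) | r : 'I_M in h l]
  ++ [seq inl o | o <- take p (drop (p * a) (word l))].

Definition label_plan (l : 'I_D) : seq instr :=
  flatten [seq stage l a | a <- iota 0 k].

Definition expander_plan : seq (seq instr) := [seq label_plan l | l : 'I_D].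

Lemma emits_stage m l a (v : 'I_m.+2 * 'I_m.+2) (I : seq instr) :
  emits (stage l a ++ I) (actw (take (p * a) (word l)) v)
  = [seq (actw (take (p * a) (word l)) v, a * M + r) | r : 'I_M in h l]
    ++ emits I (actw (take (p * a.+1) (word l)) v).
Proof.
rewrite /stage -catA /image_mem; elim: (enum _) => [|r rs IHr] /=; last by rewrite IHr.
rewrite mulnS addnC takeD actw_cat.
by move: (actw _ v) => u; elim: (take p _) u => [|o os IHo] u //=.
Qed.

Lemma emits_label m l (v : 'I_m.+2 * 'I_m.+2) :
  emits (label_plan l) v
  = flatten [seq [seq (actw (take (p * a) (word l)) v, a * M + r) | r : 'I_M in h l]
            | a <- iota 0 k].
Proof.
suff stages n a :
    emits (flatten [seq stage l b | b <- iota a n]) (actw (take (p * a) (word l)) v)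
    = flatten [seq [seq (actw (take (p * b) (word l)) v, b * M + r) | r : 'I_M in h l]
              | b <- iota a n].
  by have := stages k 0; rewrite muln0 take0.
by elim: n a => [|n IHn] a //=; rewrite emits_stage IHn.
Qed.

Lemma mem_emits m l (v : 'I_m.+2 * 'I_m.+2) x :
  x \in emits (label_plan l) v
  <-> exists2 y, y \in routed (@route m) h (v, l) & x = (y.1.1, y.1.2 * M + y.2).
Proof.
rewrite emits_label; split.
  move=> /flattenP[ys /mapP[a + ->] /imageP[r hr ->]].
  rewrite mem_iota => /andP[_ lt_a].
  exists (route l (Ordinal lt_a) v, Ordinal lt_a, r) => //.
  by rewrite inE /= eqxx.
move=> [[[w a] r]]; rewrite inE /= => /andP[/eqP -> hr] ->.
apply/flattenP; exists [seq (route l a v, a * M + r) | r : 'I_M in h l].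
  by apply/mapP; exists (val a); rewrite // mem_iota ltn_ord.
by apply/imageP; exists r.
Qed.

Lemma size_expander_plan : size expander_plan = D.
Proof. by rewrite size_map -cardE card_ord. Qed.

Lemma D_gt0 : 0 < D. Proof. by rewrite expn_gt0. Qed.

Lemma nth_expander_plan (l : 'I_D) : nth [::] expander_plan l = label_plan l.
Proof. by rewrite (nth_map l) ?nth_ord_enum // size_enum_ord. Qed.

Lemma expander_plan_offset (I : seq instr) (c : nat) :
  I \in expander_plan -> inr c \in I -> c < k * M.
Proof.
move=> /mapP[l _ ->] /flattenP[ys /mapP[a + ->]]; rewrite mem_iota => /andP[_ lt_a].
rewrite mem_cat => /orP[/imageP[r _ [->]]|/mapP[? _] //].
apply: (@leq_trans (a.+1 * M)); first by rewrite mulSn addnC ltn_add2r.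
by rewrite leq_mul2r lt_a orbT.
Qed.

Section Fixed.

Variable m : nat.
Local Notation V := ('I_m.+2 * 'I_m.+2)%type.
Local Notation G := (plan_graph expander_plan (k * M) m).

Definition left_of (u : 'I_(nL G)) : V * 'I_D :=
  (vertex m (u %/ D), Ordinal (ltn_pmod u D_gt0)).

Lemma left_of_inj : injective left_of.
Proof.
move=> u u' eq_uu'.
have lt_div (i : 'I_(nL G)) : i %/ D < m.+2 ^ 2.
  rewrite ltn_divLR ?D_gt0 //. apply: (leq_trans (ltn_ord i)).
  by rewrite /= size_expander_plan.
have eq_div : u %/ D = u' %/ D.
  have := congr1 (fun x : V * 'I_D => vindex x.1) eq_uu'.
  by rewrite /left_of !vertexK.
have eq_mod : u %% D = u' %% D := congr1 (fun x : V * 'I_D => val x.2) eq_uu'.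
by apply/val_inj; rewrite /= (divn_eq u D) (divn_eq u' D) eq_div eq_mod.
Qed.

Definition code (x : V * 'I_k * 'I_M) : nat :=
  14 + vindex x.1.1 * (k * M) + (x.1.2 * M + x.2).

Lemma code_inj : injective code.
Proof.
move=> [[w a] r] [[w' a'] r']; rewrite /code /= -!addnA => /addnI eq_code.
have M0 : 0 < M := leq_ltn_trans (leq0n _) (ltn_ord r).
have lt_aM (b : 'I_k) (t : 'I_M) : b * M + t < k * M.
  apply: (@leq_trans (b.+1 * M)); first by rewrite mulSn addnC ltn_add2r.
  by rewrite leq_mul2r ltn_ord orbT.
have kM0 := leq_ltn_trans (leq0n _) (lt_aM a r).
have eq_w : vindex w = vindex w'.
  by have := congr1 (divn^~ (k * M)) eq_code; rewrite !divnMDl // !divn_small ?addn0.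
move: eq_code; rewrite eq_w => /addnI eq_ar.
have eq_a : a = a' :> nat.
  by have := congr1 (divn^~ M) eq_ar; rewrite !divnMDl // !divn_small ?addn0.
move: eq_ar; rewrite eq_a => /addnI eq_r.
by congr (_, _, _); [apply: (can_inj (@vindexK m)) | apply: val_inj | apply: val_inj].
Qed.

Lemma row_ofE (n : nat) : row_of expander_plan (k * M) m n
  = [seq 14 + vindex x.1 * (k * M) + x.2 |
      x <- emits (label_plan (Ordinal (ltn_pmod n D_gt0))) (vertex m (n %/ D))].
Proof. by rewrite /row_of size_expander_plan -nth_expander_plan. Qed.

Lemma adjP (u : 'I_(nL G)) (v : 'I_(nR G)) :
  reflect (exists2 x, x \in routed (@route m) h (left_of u) & v = code x :> nat)
    (adj u v).
Proof.
rewrite /= row_ofE; apply: (iffP mapP).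
  by move=> [_ /mem_emits[x xr ->] ->]; exists x.
by move=> [x xr ->]; eexists; [apply/mem_emits; exists x; first exact: xr|].
Qed.

Lemma code_lt x : code x < nR G.
Proof.
case: x => -[w a] r; rewrite /code /= -addnA ltn_add2l.
apply: (@leq_trans ((vindex w).+1 * (k * M))); last first.
  by rewrite leq_mul2r vindex_lt orbT.
rewrite mulSn addnC ltn_add2r.
apply: (@leq_trans (a.+1 * M)); first by rewrite mulSn addnC ltn_add2r.
by rewrite leq_mul2r ltn_ord orbT.
Qed.

(** The right vertices outside its image are the padding ones. *)
Definition right_of (x : V * 'I_k * 'I_M) : 'I_(nR G) := Ordinal (code_lt x).

Lemma right_of_inj : injective right_of.
Proof. by move=> x y /(congr1 val) /= /code_inj. Qed.

Lemma nbrs_right_of (S : {set 'I_(nL G)}) :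
  nbrs S = right_of @: \bigcup_(u in left_of @: S) routed (@route m) h u.
Proof.
apply/setP => v; rewrite inE; apply/exists_inP/imsetP.
  move=> [u uS /adjP[x xr vx]]; exists x; last exact: val_inj.
  by apply/bigcupP; exists (left_of u) => //; apply: imset_f.
move=> [x /bigcupP[_ /imsetP[u uS ->] xr] ->]; exists u => //.
by apply/adjP; exists x.
Qed.

Lemma expander_plan_regular : (forall l, #|h l| = d) -> left_regular (k * d) G.
Proof.
move=> hd u; rewrite -(card_routed (@route m) (left_of u) hd).
rewrite -(card_imset _ right_of_inj); apply: eq_card => v; rewrite inE.
apply/adjP/imsetP => -[x xr vx]; exists x => //; first exact: val_inj.
by rewrite vx.
Qed.

Lemma route_inj l a : injective (@route m l a).
Proof. exact: actw_inj. Qed.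

(** Cut the word at times p a and p b. The first part permutes the starting points and the last one
    is irrelevant to the event, so both are free and contribute the power of 5. *)
Lemma card_pairs (a b : 'I_k) (A B : {set V}) : a < b ->
  #|[set u : V * 'I_D | (route u.2 a u.1 \in A) && (route u.2 b u.1 \in B)]|
  = 5 ^ (p * k.-1 - p * (b - a)) *
    \sum_(w <- words (p * (b - a))) #|[set v in A | actw w v \in B]|.
Proof.
move=> ab.
pose F w := #|[set v : V | (actw (take (p * a) w) v \in A)
                        && (actw (take (p * b) w) v \in B)]|.
transitivity (\sum_(l : 'I_D) F (word l)).
  under [RHS]eq_bigr do rewrite /F -sum1dep_card.
  rewrite (exchange_big_dep xpredT) //= pair_big_dep /= sum1dep_card.
  by apply: eq_card => u; rewrite !inE.
transitivity (\sum_(w <- words (p * k.-1)) F w).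
  rewrite (big_nth [::]) big_mkord size_words; exact: eq_bigr.
have lt_b := ltn_ord b.
have -> : p * k.-1 = p * a + (p * (b - a) + p * (k.-1 - b)).
  by rewrite -!mulnDr; congr (_ * _); lia.
rewrite sum_words_cat.
transitivity (\sum_(w1 <- words (p * a)) \sum_(w2 <- words (p * (b - a)))
    5 ^ (p * (k.-1 - b)) * #|[set v in A | actw w2 v \in B]|).
  apply: eq_big_seq => w1 /size_word size_w1.
  rewrite sum_words_cat; apply: eq_big_seq => w2 /size_word size_w2.
  transitivity (\sum_(w3 <- words (p * (k.-1 - b)))
      #|[set v in A | actw w2 v \in B]|); last first.
    by rewrite big_const_seq count_predT size_words iter_addn_0 mulnC.
  apply: eq_bigr => w3 _; rewrite /F take_size_cat // catA take_size_cat; last first.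
    by rewrite size_cat size_w1 size_w2 -mulnDr subnKC // ltnW.
  rewrite -[RHS](card_preimset _ (@actw_inj m w1)); apply: eq_card => v.
  by rewrite !inE actw_cat.
rewrite big_const_seq count_predT size_words iter_addn_0 -big_distrr /=.
rewrite mulnAC -expnD; congr (5 ^ _ * _).
by rewrite addnCA addKn addnC.
Qed.

Variables (z q : nat).
Hypothesis h_expands : forall S : {set 'I_D}, #|S| * z <= D ->
  (d - 2) * #|S| <= #|\bigcup_(l in S) h l|.
Hypothesis q_def : q = k ^ 3 * z.
Hypotheses (k0 : 0 < k) (z0 : 0 < z).
Hypothesis mixing : forall p', p <= p' ->
  forall (A B : {set V}) tau,
    #|A| <= tau -> #|B| <= tau -> 2 * q * tau <= m.+2 ^ 2 ->
    q * (\sum_(w <- words p') #|[set v in A | actw w v \in B]|) <= 5 ^ p' * tau.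

Lemma expander_plan_expands (S : {set 'I_(nL G)}) :
  #|S| * (2 * q * z) <= nL G -> (d - 2) * (k - 2) * #|S| <= #|nbrs S|.
Proof.
have cardV : #|{: V}| = m.+2 ^ 2 by rewrite card_prod card_ord mulnn.
rewrite nbrs_right_of (card_imset _ right_of_inj) => S_small.
rewrite -(card_imset _ left_of_inj).
apply: (routed_expands route_inj h_expands _ q_def k0 z0 D_gt0).
  move=> a b A B tau ab cA cB; rewrite cardV => le_tau.
  rewrite (card_pairs _ _ ab) mulnCA.
  have le_D : p * (b - a) <= p * k.-1.
    by rewrite leq_mul2l; apply/orP; right; have := ltn_ord b; lia.
  rewrite -[X in _ <= 5 ^ X * _](subnK le_D) expnD -mulnA leq_mul2l.
  (* Distinct observation times are at least [p] steps apart. *)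
  by rewrite mixing ?orbT // leq_pmulr // subn_gt0.
by rewrite cardV (card_imset _ left_of_inj) -size_expander_plan.
Qed.

End Fixed.

End ExpanderPlan.

(** With gadget degree equal to the number of blocks, (k - 2)^2 >= k^2 - 4 k >= (1 - eps) k^2. *)
Lemma expander_plan_lossless (R : realType) (eps : R) (k p M z q m : nat)
    (h : 'I_(5 ^ (p * k.-1)) -> {set 'I_M}) :
  (2 < k)%N -> 4 <= eps * k%:R -> (0 < z)%N -> q = (k ^ 3 * z)%N ->
  (forall l, #|h l| = k) ->
  (forall S : {set 'I_(5 ^ (p * k.-1))}, (#|S| * z <= 5 ^ (p * k.-1))%N ->
    ((k - 2) * #|S| <= #|\bigcup_(l in S) h l|)%N) ->
  (forall p', (p <= p')%N ->
    forall (A B : {set 'I_m.+2 * 'I_m.+2}) (tau : nat),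
    (#|A| <= tau)%N -> (#|B| <= tau)%N -> (2 * q * tau <= m.+2 ^ 2)%N ->
    (q * (\sum_(w <- words p') #|[set v in A | actw w v \in B]|)
     <= 5 ^ p' * tau)%N) ->
  lossless_expander (2 * q * z)%:R^-1 eps (k * k)
    (plan_graph (expander_plan h) (k * M) m).
Proof.
move=> k_ge3 k_eps z0 q_def h_card h_exp mixing.
have k_gt0 : (0 < k)%N := ltnW (ltnW k_ge3).
have qz0 : (0 < 2 * q * z)%N by rewrite q_def !muln_gt0 ?expn_gt0 k_gt0 z0.
split; first exact: expander_plan_regular.
move=> S S_small.
have le_S : (#|S| * (2 * q * z)
    <= nL (plan_graph (expander_plan h) (k * M) m))%N.
  by rewrite -(ler_nat R) natrM -ler_pdivlMr ?ltr0n // mulrC.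
have := expander_plan_expands h_exp q_def k_gt0 z0 mixing le_S.
rewrite -(ler_nat R) !natrM natrB; last exact: ltnW.
apply: le_trans; apply: ler_wpM2r; first exact: ler0n.
have : 4 * k%:R <= eps * k%:R * k%:R by apply: ler_wpM2r.
lra.
Qed.

(** Rounding [M] up adds less than [width] to the ratio, and so does the padding. *)
Lemma density_bounds (R : realFieldType) (beta width : R) (k M D n : nat) :
  0 < width -> (0 < k)%N -> (0 < D)%N -> (0 < n)%N ->
  M%:R - 1 <= beta * D%:R / k%:R < M%:R ->
  k%:R < width * D%:R -> 14 / width < n%:R ->
  beta - 2 * width < (14 + n * (k * M))%:R / (n * D)%:R < beta + 2 * width.
Proof.
move=> width0 k0 D0 n0 /andP[M_le M_gt] k_lt n_large.
rewrite natrD !natrM; rewrite ltr_pdivrMr // in n_large.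
have kR : 0 < k%:R :> R by rewrite ltr0n.
have D_ge1 : 1 <= D%:R :> R by rewrite ler1n.
have nR : 0 < n%:R :> R by rewrite ltr0n.
have DR := lt_le_trans ltr01 D_ge1; have nD0 := mulr_gt0 nR DR.
have kM_gt : beta * D%:R < k%:R * M%:R.
  by rewrite mulrC -[ltRHS]mulrC -ltr_pdivrMr // mulrC.
have kM_le : k%:R * M%:R <= beta * D%:R + k%:R.
  rewrite -lerBlDr -{2}[k%:R]mulr1 -mulrBr mulrC.
  by rewrite -ler_pdivlMr.
move: (k%:R : R) (M%:R : R) (D%:R : R) (n%:R : R) nR DR nD0 D_ge1 kM_gt kM_le
  k_lt n_large {k0 D0 n0 M_le M_gt kR} => K m E N.
move=> nR DR nD0 D_ge1 kM_gt kM_le k_lt n_large.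
rewrite ltr_pdivlMr // ltr_pdivrMr //; apply/andP; split.
  have : N * (beta * E) < N * (K * m) by rewrite ltr_pM2l.
  have := mulr_gt0 width0 nD0; lra.
have : N * (K * m) <= N * (beta * E + K) by rewrite ler_pM2l.
have : N * K < N * (width * E) by rewrite ltr_pM2l.
have : N * width <= N * width * E by rewrite ler_peMr // ltW // mulr_gt0.
lra.
Qed.

Unset Implicit Arguments.

Theorem theorem1p2 (R : realType) (beta1 beta2 eps : R)
    (beta1_ge0 : 0 <= beta1) (lt_beta : beta1 < beta2) (eps_gt0 : 0 < eps) :
  exists (D : nat) (mu : R),
    [/\ (0 < D)%N, 0 < mu, mu <= 1 &
      exists G : nat -> bigraph,
        infinite_explicit_family G /\
        forall n : nat,
          lossless_expander mu eps D (G n) /\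
          beta1 < (nR (G n))%:R / (nL (G n))%:R < beta2].
Proof.
pose width := (beta2 - beta1) / 4; pose beta := (beta1 + beta2) / 2.
have width0 : 0 < width by rewrite /width; lra.
have beta0 : 0 < beta by rewrite /beta; lra.
have large (x : R) : exists n0 : nat, forall n, (n0 <= n)%N -> x < n%:R.
  exists (Num.bound (Num.max 0 x)) => n le_n.
  apply: le_lt_trans (_ : Num.max 0 x < _); first by rewrite le_max lexx orbT.
  have x0 : 0 <= Num.max 0 x by rewrite le_max lexx.
  by apply: lt_le_trans (archi_boundP x0) _; rewrite ler_nat.
have [k0 k0P] := large (4 / eps); pose k := (k0 + 3)%N.
have k_ge3 : (3 <= k)%N by rewrite leq_addl.
have k_gt0 : (0 < k)%N := ltnW (ltnW k_ge3).
have kR : 0 < k%:R :> R by rewrite ltr0n.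
have k_eps : 4 <= eps * k%:R.
  by rewrite mulrC -ler_pdivrMr // ltW // k0P // leq_addr.
(* [M] will exceed beta D / k, so k / beta bounds D / M before D is known. *)
have [g0 g0P] := large (k%:R / beta); pose g := g0.+1.
have [z z0 gadget] := @gadget_exists k g (ltnW k_ge3) (ltn0Sn _).
pose q := (k ^ 3 * z)%N; have q0 : (0 < q)%N by rewrite muln_gt0 expn_gt0 k_gt0 z0.
have [p0 mixing] := expander_mixing q0.
(* [p1] forces k <= M, so that gadget neighbourhoods exist; [p2] makes the rounding of [M] small
   against [width]. *)
have [p1 p1P] := large (k%:R * k%:R / beta); have [p2 p2P] := large (k%:R / width).
pose p := (p0 + p1 + p2)%N; pose D := (5 ^ (p * k.-1))%N.
have p0_le_p : (p0 <= p)%N by rewrite /p -addnA leq_addr.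
have p_le_D : (p <= D)%N.
  apply: leq_trans (ltnW (ltn_expl p (isT : 1 < 5)%N)) _.
  by rewrite leq_pexp2l // leq_pmulr //; lia.
have D0 : 0 < D%:R :> R by rewrite ltr0n expn_gt0.
have D1P : k%:R * k%:R / beta < D%:R 
  by apply/p1P/(leq_trans _ p_le_D); rewrite /p addnAC leq_addl.
have D2P : k%:R / width < D%:R 
  by apply/p2P/(leq_trans _ p_le_D); rewrite /p leq_addl.
pose M := (Num.truncn (beta * D%:R / k%:R)).+1.
have x0 : 0 <= beta * D%:R / k%:R.
  exact: (divr_ge0 (ltW (mulr_gt0 beta0 D0)) (ltW kR)).
have M_itv : M%:R - 1 <= beta * D%:R / k%:R < M%:R.
  have := truncn_itv x0; rewrite -/M => /andP[h1 h2].
  by rewrite h2 andbT -natr1 addrK.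
have M_gt : beta * D%:R / k%:R < M%:R by case/andP: M_itv.
have D_le : (D <= g * M)%N.
  rewrite -(ler_nat R) natrM; apply: (@le_trans _ _ (k%:R / beta * M%:R)).
    rewrite mulrAC ler_pdivlMr // -ler_pdivrMl // mulrC [_ * beta]mulrC.
    exact: ltW.
  by apply: ler_wpM2r; rewrite ?ler0n // ltW // g0P.
have k_le_M : (k <= M)%N.
  rewrite -(ler_nat R); apply: ltW; apply: lt_trans M_gt.
  by rewrite ltr_pdivlMr // -ltr_pdivrMl // mulrC.
have [h [h_card h_exp]] := gadget D M D_le k_le_M.
(* Starting the family at [m0] makes the padding negligible already for its first member. *)
have [m0 m0P] := large (14 / width).
pose G n := plan_graph (expander_plan h : seq (seq instr)) (k * M) (m0 + n).
have qz0 : (0 < 2 * q * z)%N by rewrite muln_gt0 z0 andbT mul2n double_gt0.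
exists (k * k)%N, (2 * q * z)%:R^-1; split.
- by rewrite muln_gt0 k_gt0.
- by rewrite invr_gt0 ltr0n.
- by rewrite invf_le1 ?ltr0n // ler1n.
exists G; split; first split.
- move=> n; exists n; rewrite /Defs.order /G /= size_expander_plan -mulnn.
  apply: leq_trans (leq_addr _ _); rewrite -mulnA.
  apply: (@leq_trans (m0 + n).+2); first by rewrite !leqW // leq_addl.
  by rewrite leq_pmulr // muln_gt0 D_gt0.
- apply: plan_poly_time; first by rewrite size_expander_plan D_gt0.
  exact: expander_plan_offset.
move=> n; split.
  apply: (@expander_plan_lossless R eps k p M z q (m0 + n) h) => //.
  by move=> p' le_p; exact: (mixing p' (leq_trans p0_le_p le_p)).
have -> : beta1 = beta - 2 * width by rewrite /beta /width; clear; lra.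
have -> : beta2 = beta + 2 * width by rewrite /beta /width; clear; lra.
rewrite /G /= size_expander_plan; apply: density_bounds => //.
- by rewrite expn_gt0.
- by rewrite mulrC -ltr_pdivrMr.
- apply: m0P; apply: (@leq_trans (m0 + n).+2); first by rewrite !leqW // leq_addr.
  by rewrite -mulnn leq_pmulr.
Qed.
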